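(* There is an absolute constant $C>0$ such that the following holds. Let $n\ge1$, $K>0$, and let $P=\mu_1\otimes\cdots\otimes\mu_n$ be a product probability measure on $\mathbb{R}^n$, where every $\mu_i$ is a probability measure on $\mathbb{R}$ with $\psi_2$-norm at most $K$. Let $Q\ll P$ be a probability measure with $H=D(Q\Vert P)<\infty$. Then there is a coupling $(X,Y)$ with $X\sim P$ and $Y\sim Q$ which satisfies simultaneously $$\sum_{i=1}^n\mathbb{E}\left[\mathbb{E}(|X_i-Y_i|\mid X)^2\right]\le CK^2\,\Psi_n(H),$$ $$\sum_{i=1}^n\mathbb{E}\left[\mathbb{E}(|X_i-Y_i|\mid Y)^2\right]\le CK^2\,\Psi_n(H),$$ $$\mathbb{E}\|X-Y\|^2\le CK^2(\sqrt{nH}+H).$$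
   Context: $D(Q\Vert P)=\int\log(dQ/dP)\,dQ$ is relative entropy. A probability measure $\mu$ on $\mathbb{R}$ has $\psi_2$-norm at most $K$ if $\int e^{x^2/K^2}\,d\mu(x)\le2$. $\Psi_n(h)=h\log(e+n/h)$ for $h>0$ and $\Psi_n(0)=0$. $\|\cdot\|$ is the Euclidean norm on $\mathbb{R}^n$. $\mathbb{E}(W\mid X)^2$ means $(\mathbb{E}(W\mid X))^2$. *)

(* Defs.v *)
From HB Require Import structures.
From mathcomp Require Import all_boot all_order all_algebra.
From mathcomp Require Import all_classical all_reals all_analysis.

Set Implicit Arguments.
Unset Strict Implicit.
Unset Printing Implicit Defensive.

Import Order.TTheory GRing.Theory Num.Theory.

Local Open Scope classical_set_scope.
Local Open Scope ring_scope.
Local Open Scope ereal_scope.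
Local Open Scope charge_scope.

(* R^n with the product sigma-algebra of the Borel sigma-algebras, which is
   the Borel sigma-algebra of R^n. *)
Notation Rn R n := (n.-tuple (measurableTypeR R)).

(* Q is assumed to be dominated by P wherever this is used: without domination
   the library's 'd _ '/d _ is a dummy value. The value [lne 0 = -oo] is only
   taken on a Q-null set. *)
Definition relative_entropy d (T : measurableType d) (R : realType)
    (Q P : probability T R) : \bar R :=
  \int[Q]_x lne (('d (charge_of_finite_measure Q) '/d P) x).

Definition psi2_norm_le (R : realType)
    (mu : probability (measurableTypeR R) R) (K : R) : Prop :=
  \int[mu]_x (expR (x ^+ 2 / K ^+ 2))%:E <= 2%:E.

Definition Psi (R : realType) (n : nat) (h : R) : R :=
  (if h == 0 then 0 else h * ln (expR 1 + n%:R / h))%R.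

(* The measurable rectangles form a pi-system that generates the
   sigma-algebra, so this determines P. *)
Definition is_product_measure (R : realType) (n : nat)
    (mu : 'I_n -> probability (measurableTypeR R) R)
    (P : probability (Rn R n) R) : Prop :=
  forall A : 'I_n -> set (measurableTypeR R), (forall i, measurable (A i)) ->
    P [set x | forall i, A i (tnth x i)] = \prod_(i < n) mu i (A i).

Definition eucl_norm (R : realType) (n : nat) (x : 'I_n -> R) : R :=
  Num.sqrt (\sum_(i < n) x i ^+ 2)%R.

(* Z is a version of E(W | X): it is measurable for the sigma-algebra
   generated by X, and has the same integral as W on each of its sets. *)
Definition is_cond_exp d d' (T : measurableType d) (T' : measurableType d')
    (R : realType) (Pr : probability T R) (W : T -> R)
    (X : {RV Pr >-> T'}) (Z : T -> R) : Prop :=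
  [/\ Pr.-integrable setT (EFin \o W),
      Pr.-integrable setT (EFin \o Z),
      (forall B : set (measurableTypeR R), measurable B ->
         g_sigma_algebra_preimage X (Z @^-1` B)) &
      (forall A, g_sigma_algebra_preimage X A ->
         \int[Pr]_(w in A) (Z w)%:E = \int[Pr]_(w in A) (W w)%:E)].

Definition has_law d d' (T : measurableType d) (T' : measurableType d')
    (R : realType) (Pr : probability T R) (X : {RV Pr >-> T'})
    (mu : probability T' R) : Prop :=
  forall A, measurable A -> distribution Pr X A = mu A.

(* Main.v *)
Require Import Defs.
From HB Require Import structures.
From mathcomp Require Import all_boot all_order all_algebra.
From mathcomp Require Import all_classical all_reals all_analysis.
From mathcomp Require Import measurable_realfun ring lra.

(** Write [Q = F P]. The coupling is built one coordinate at a time, and each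
    coordinate is coupled by a maximal (total variation) coupling.

    One coordinate. Let [nu = f mu] on the line. The maximal coupling puts
    [X = Y] on the common part [min(f, 1) mu], and otherwise draws [X] from
    [(1 - f)_+ mu / t] and [Y] independently from [(f - 1)_+ mu / t], where [t]
    is the total variation distance. So E(|X - Y| | X = x) is [(1 - f(x))_+]
    times an average of |x - z|, and E(|X - Y| | Y = y) is [(1 - 1/f(y))_+]
    times such an average. Let [ent u = u ln u - u + 1], so that
    [h = \int ent f dmu] is the entropy of [nu]. Both [(1 - u)_+ ^ 2] and
    [(u - 1)_+ ^ 2 / u] are at most [4 ent u], because
    [ent u >= (sqrt u - 1) ^ 2]. The weight [b = x^2 / K^2] coming from
    |x - z|^2 is removed by Young's inequality
    [c b <= c L + c ln c + exp (b - L)], where the subgaussian hypothesis bounds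
    the integral of [exp b]. The outcome is, for all [L >= 0] and [r > 0], that
    the two weak costs are at most [28 K^2 ((1 + L) h + exp (- L))] and the
    quadratic cost is at most [K^2 ((20 / r + 18) h + 8 r)]
    ([weak_cost_fst], [weak_cost_snd], [sqr_cost]).

    All coordinates. These bounds are affine in [h], with free parameters [L] and
    [r] that the coupling does not depend on. Hence they can be added up over
    the coordinates with the chain rule for entropy ([entropy_chain]) alone, and
    the concave functions [Psi] and [sqrt] appear only when [L = ln (e + n / H)]
    and [r = sqrt (H / n)] are chosen at the very end ([le_Psi],
    [le_sqrt_entropy]). To add a coordinate, couple the tails first, and then
    couple the head of [X], of law [mu_0], with the head of [Y], whose law is the
    conditional law given the tail of [Y]. The head of [X] is then independent of
    both tails, so that [X] has law [P]. The conditional laws have explicit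
    densities, quotients of [F] by its marginal density ([cond_density]).

    Conditional expectations. A bound [\sum_i E (E(W_i | X) ^ 2) <= B] is dual to
    [\sum_i E (2 W_i phi_i(X)) <= B + \sum_i E (phi_i(X) ^ 2)] for all test
    functions [phi_i >= 0] (take for [phi_i] a truncation of the conditional
    expectation, [sqr_cond_exp_bound]). The dual form is what passes through the
    induction: on the [X] side the head of [X] is independent of the tails and
    can be frozen; on the [Y] side [phi_i] is averaged over the head of [Y] given
    its tail, which does not increase its square by Jensen's inequality
    ([transport_coupling_step], [exists_transport_coupling]). *)

Set Implicit Arguments.
Unset Strict Implicit.
Unset Printing Implicit Defensive.

Import Order.TTheory GRing.Theory Num.Theory.

Local Open Scope classical_set_scope.
Local Open Scope ring_scope.

(** * Pointwise inequalities for the entropy integrand *)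

Section RealIneq.
Context {R : realType}.
Implicit Types (u b c L r s : R).

(** The integrand of relative entropy, normalised to be nonnegative: the
    integral of [ent f] is the entropy of [f mu] relative to [mu] whenever [f mu]
    has mass 1. *)
Definition ent u : R := u * ln u - u + 1.
Definition defect u : R := Num.max (1 - u) 0.
Definition excess u : R := Num.max (u - 1) 0.
(** For the mass [excess u] that is moved, seen from the target measure: the
    conditional probability of moving is [excess u / u], and the integral of its
    square against [u mu] is the integral of [chi u]. *)
Definition chi u : R := excess u ^+ 2 / u.

Lemma defect_ge0 u : 0 <= defect u.
Proof. by rewrite /defect le_max lexx orbT. Qed.

Lemma excess_ge0 u : 0 <= excess u.
Proof. by rewrite /excess le_max lexx orbT. Qed.

Lemma defect_le1 u : 0 <= u -> defect u <= 1.
Proof. by move=> u0; rewrite /defect ge_max ler01 andbT; lra. Qed.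

Lemma defect_excess u : u + defect u = 1 + excess u.
Proof. by rewrite /defect /excess; case: (leP 0 (1 - u)); case: (leP 0 (u - 1)) => *; lra. Qed.

Lemma excessE u : 1 <= u -> excess u = u - 1.
Proof. by move=> u1; rewrite /excess; apply/max_idPl; lra. Qed.

Lemma excess0 u : u <= 1 -> excess u = 0.
Proof. by move=> u1; rewrite /excess; apply/max_idPr; lra. Qed.

Lemma defectE u : u <= 1 -> defect u = 1 - u.
Proof. by move=> u1; rewrite /defect; apply/max_idPl; lra. Qed.

Lemma defect0 u : 1 <= u -> defect u = 0.
Proof. by move=> u1; rewrite /defect; apply/max_idPr; lra. Qed.

Lemma ln_le_sub1 u : 0 < u -> ln u <= u - 1.
Proof. by move=> u0; have := @le_ln1Dx R (u - 1); rewrite [1 + _]addrC subrK; apply; lra. Qed.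

(** This is [ln u = 2 ln (sqrt u) >= 2 (1 - 1 / sqrt u)]. Squared Hellinger
    distance is thus the common lower bound from which the estimates on [defect]
    and [chi] follow. *)
Lemma sqr_sqrtB1_le_ent u : 0 <= u -> (Num.sqrt u - 1) ^+ 2 <= ent u.
Proof.
rewrite le_eqVlt => /predU1P[<-|u0].
  by rewrite /ent sqrtr0 mul0r; lra.
have v0 : 0 < Num.sqrt u by rewrite sqrtr_gt0.
have uE : u = Num.sqrt u ^+ 2 by rewrite sqr_sqrtr ?ltW.
move: (Num.sqrt u) v0 uE => v v0 ->; rewrite /ent expr2 lnM ?posrE//.
have : ln v^-1 <= v^-1 - 1 by apply: ln_le_sub1; rewrite invr_gt0.
rewrite lnV ?posrE// => lnv.
have : v * v * (1 - v^-1) <= v * v * ln v by rewrite ler_pM2l ?mulr_gt0//; lra.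
have -> : v * v * (1 - v^-1) = v * v - v by field; rewrite gt_eqF.
lra.
Qed.

Lemma ent_ge0 u : 0 <= u -> 0 <= ent u.
Proof. by move=> /sqr_sqrtB1_le_ent; apply: le_trans; rewrite sqr_ge0. Qed.

(** Factor [1 - u = (1 - sqrt u) (1 + sqrt u)] with [sqrt u <= 1]. *)
Lemma sqr_defect_le_ent u : 0 <= u -> defect u ^+ 2 <= 4 * ent u.
Proof.
move=> u0; have [u1|u1] := leP u 1; last first.
  by rewrite (defect0 (ltW u1)) expr2 mul0r mulr_ge0// ent_ge0.
rewrite defectE//; have := sqr_sqrtB1_le_ent u0.
have v0 := sqrtr_ge0 u.
have uE : u = Num.sqrt u ^+ 2 by rewrite sqr_sqrtr.
have v1 : Num.sqrt u <= 1 by rewrite -sqrtr1 ler_sqrt.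
move: (Num.sqrt u) v0 uE v1 => v v0 uE v1 h.
apply: (@le_trans _ _ (4 * (v - 1) ^+ 2)); last by rewrite ler_pM2l.
rewrite uE; have -> : (1 - v ^+ 2) ^+ 2 = (1 + v) ^+ 2 * (v - 1) ^+ 2 by ring.
by rewrite ler_wpM2r ?sqr_ge0//; nra.
Qed.

Lemma chi_ge0 u : 0 <= u -> 0 <= chi u.
Proof. by move=> u0; rewrite /chi divr_ge0 ?sqr_ge0. Qed.

Lemma mul_chi u : 0 <= u -> u * chi u = excess u ^+ 2.
Proof.
rewrite le_eqVlt => /predU1P[<-|u0]; last by rewrite /chi mulrC divfK ?gt_eqF.
by rewrite mul0r excess0 ?expr0n.
Qed.

Lemma chi_le_excess u : 0 <= u -> chi u <= excess u.
Proof.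
move=> u0; have [u1|u1] := leP u 1.
  by rewrite /chi excess0// expr2 !mul0r.
by rewrite /chi (excessE (ltW u1)) ler_pdivrMr; nra.
Qed.

(** The same factorisation, divided by [u]: here [(1 + 1 / sqrt u) ^ 2 <= 4]. *)
Lemma chi_le_ent u : 0 <= u -> chi u <= 4 * ent u.
Proof.
move=> u0; have [u1|u1] := leP u 1.
  by rewrite /chi excess0// expr2 !mul0r mulr_ge0// ent_ge0.
have := sqr_sqrtB1_le_ent u0.
have uE : u = Num.sqrt u ^+ 2 by rewrite sqr_sqrtr.
have v1 : 1 <= Num.sqrt u by rewrite -sqrtr1 ler_sqrt// ltW.
rewrite /chi (excessE (ltW u1)) ler_pdivrMr; last lra.
move: (Num.sqrt u) uE v1 => v uE v1 h.
apply: (@le_trans _ _ (4 * (v - 1) ^+ 2 * u)); last by rewrite ler_wpM2r// ler_pM2l.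
rewrite uE; have -> : (v ^+ 2 - 1) ^+ 2 = (1 + v) ^+ 2 * (v - 1) ^+ 2 by ring.
rewrite [leRHS]mulrAC ler_wpM2r ?sqr_ge0//; nra.
Qed.

(** Here [excess u <= 2 chi u]. *)
Lemma excess_le_ent u : 2 <= u -> excess u <= 8 * ent u.
Proof.
move=> u2; have u0 : 0 <= u by lra.
have := chi_le_ent u0; rewrite /chi excessE; last lra.
rewrite ler_pdivrMr; last lra.
have := ent_ge0 u0; nra.
Qed.

Lemma excess_ln_le u : 0 <= u -> excess u * ln (excess u) <= ent u + excess u.
Proof.
move=> u0; have [u1|u1] := leP u 1.
  by rewrite excess0// mul0r addr0 ent_ge0.
rewrite (excessE (ltW u1)) /ent.
have h1 : ln (u - 1) <= ln u by rewrite ler_ln ?posrE; lra.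
have h2 : 0 <= ln u by rewrite ln_ge0// ltW.
have : (u - 1) * ln (u - 1) <= (u - 1) * ln u by rewrite ler_wpM2l//; lra.
nra.
Qed.

(** Fenchel-Young inequality for the exponential, shifted by [L]: large [L]
    makes the exponential term small at the price of the linear term [c L]. *)
Lemma young c b L : 0 <= c -> c * b <= c * L + c * ln c + expR (- L) * expR b.
Proof.
rewrite le_eqVlt => /predU1P[<-|c0].
  by rewrite !mul0r !add0r mulr_ge0// expR_ge0.
have -> : expR (- L) * expR b = c * expR (b - L - ln c).
  rewrite !expRD [in expR (- ln c)]expRN lnK ?posrE//.
  rewrite [RHS]mulrC -[RHS]mulrA mulVf ?gt_eqF// mulr1 mulrC//.
rewrite -!mulrDr ler_pM2l//.
have := @expR_ge1Dx R (b - L - ln c); lra.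
Qed.

Lemma young_le1 c b L : 0 <= c <= 1 -> c * b <= c * L + expR (- L) * expR b.
Proof.
move=> /andP[c0 c1]; apply: (le_trans (young b L c0)).
by rewrite lerD2r gerDl mulr_ge0_le0// ln_le0.
Qed.

(** The next four bounds feed [young] with each of the weights that occur in
    the transport costs. The first and the last one contain no [excess] and no
    [defect] on the right: these are the weights that multiply the square of the
    coordinate directly, and a term of order [t] would be too large there. *)
Lemma sqr_defect_young u b L : 0 <= u -> 0 <= L ->
  defect u ^+ 2 * b <= 4 * L * ent u + expR (- L) * expR b.
Proof.
move=> u0 L0; have := @young_le1 (defect u ^+ 2) b L.
rewrite sqr_ge0/= expr_le1// ?defect_ge0// defect_le1// => /(_ isT)/le_trans; apply.
rewrite lerD2r mulrC -mulrA [4 * _]mulrCA ler_wpM2l//; exact: sqr_defect_le_ent.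
Qed.

Lemma defect_young u b L : 0 <= u ->
  defect u * b <= L * defect u + expR (- L) * expR b.
Proof. by move=> u0; rewrite [L * _]mulrC; apply: young_le1; rewrite defect_ge0 defect_le1. Qed.

Lemma excess_young u b L : 0 <= u ->
  excess u * b <= (L + 1) * excess u + ent u + expR (- L) * expR b.
Proof.
move=> u0; apply: (le_trans (young b L (excess_ge0 u))).
have := excess_ln_le u0; lra.
Qed.

Lemma chi_young u b L : 0 <= u -> 0 <= L ->
  chi u * b <= (4 * L + 9) * ent u + expR (- L) * expR b.
Proof.
move=> u0 L0; apply: (le_trans (young b L (chi_ge0 u0))).
rewrite lerD2r.
have h1 := chi_le_ent u0; have h0 := chi_ge0 u0; have e0 := ent_ge0 u0.
(* The logarithm is positive only if [chi u > 1], which forces [u >= 2]. *)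
have : chi u * ln (chi u) <= 9 * ent u.
  have [c1|c1] := leP (chi u) 1.
    apply: (@le_trans _ _ 0); last by rewrite mulr_ge0.
    by rewrite mulr_ge0_le0// ln_le0.
  have q1 : 1 < excess u by apply: (lt_le_trans c1); exact: chi_le_excess.
  have u2 : 2 <= u.
    have [|u1] := leP 1 u; first by move=> /excessE qE; rewrite qE in q1; lra.
    by move: q1; rewrite (excess0 (ltW u1)) ltr10.
  apply: (@le_trans _ _ (excess u * ln (excess u))).
    apply: ler_pM => //; first by rewrite ln_ge0// ltW.
      exact: chi_le_excess.
    by rewrite ler_ln ?posrE ?chi_le_excess// (lt_trans ltr01).
  apply: (le_trans (excess_ln_le u0)); have := excess_le_ent u2; lra.
nra.
Qed.

Lemma sqr_le_2expR b : 0 <= b -> b ^+ 2 <= 2 * expR b.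
Proof.
move=> b0; have := @expR_ge1Dxn R b 1 b0; rewrite (_ : 2`! = 2)%N// => h.
by lra.
Qed.

Lemma am_gm c b r : 0 <= b -> 0 < r ->
  c * b <= c ^+ 2 / (2 * r) + r * expR b.
Proof.
move=> b0 r0; have := sqr_le_2expR b0.
have : 0 <= (c - r * b) ^+ 2 / (2 * r) by rewrite divr_ge0 ?sqr_ge0// mulr_ge0// ltW.
have -> : (c - r * b) ^+ 2 / (2 * r) = c ^+ 2 / (2 * r) - c * b + r * b ^+ 2 / 2.
  by field; rewrite gt_eqF.
nra.
Qed.

(** For the quadratic cost [young] would lose a logarithm near [u = 1]. There,
    [c b <= c^2 / (2 r) + r b^2 / 2] is used, with [b^2 <= 2 exp b]; both bounds
    are affine in [ent u], with a free [r]. *)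
Lemma defect_am_gm u b r : 0 <= u -> 0 <= b -> 0 < r ->
  defect u * b <= 2 / r * ent u + r * expR b.
Proof.
move=> u0 b0 r0; apply: (le_trans (am_gm _ b0 r0)).
rewrite lerD2r; have -> : 2 / r * ent u = (4 * ent u) / (2 * r).
  by field; rewrite gt_eqF.
by rewrite ler_wpM2r ?invr_ge0 ?sqr_defect_le_ent// mulr_ge0// ltW.
Qed.

Lemma excess_am_gm u b r : 0 <= u -> 0 <= b -> 0 < r ->
  excess u * b <= (8 / r + 9) * ent u + r * expR b.
Proof.
move=> u0 b0 r0; have e0 := ent_ge0 u0.
have ri : 0 < r^-1 by rewrite invr_gt0.
have [u2|u2] := leP u 2.
  apply: (le_trans (am_gm _ b0 r0)); rewrite lerD2r.
  have : excess u ^+ 2 <= 8 * ent u.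
    rewrite -mul_chi//; have := chi_le_ent u0; have := chi_ge0 u0; nra.
  rewrite invfM; nra.
(* Far from [u = 1], [young] with [exp (- L) = r] and [- ln r <= 1 / r]. *)
have := young b (- ln r) (excess_ge0 u); rewrite opprK lnK ?posrE// => /le_trans; apply.
rewrite lerD2r.
have h : - ln r <= r^-1 - 1 by rewrite -lnV ?posrE//; exact: ln_le_sub1.
have h2 := excess_le_ent (ltW u2); have h3 := excess_ge0 u.
have h4 := excess_ln_le u0.
have : excess u * - ln r <= excess u * r^-1 by rewrite ler_wpM2l//; lra.
have : excess u * r^-1 <= 8 * ent u * r^-1 by rewrite ler_wpM2r// ltW.
lra.
Qed.

End RealIneq.

Local Open Scope ereal_scope.

(** * Measures given by a density *)

(** [P0] is the default value in the normalisation of a measure. *)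
Lemma probability_of_measure d (T : measurableType d) (R : realType)
    (m : {measure set T -> \bar R}) (P0 : probability T R) :
  m setT = 1 -> exists P : probability T R, forall A, P A = m A.
Proof.
move=> m1; exists (mnormalize m P0) => A.
by rewrite /= /mnormalize m1 /= onee_eq0/= invr1 mule1.
Qed.

Lemma integral_cst_probability d (T : measurableType d) (R : realType)
    (P : probability T R) (c : \bar R) : \int[P]__ c = c.
Proof. by rewrite integral_cst// [X in _ * X]probability_setT mule1. Qed.

Section DensityMeasure.
Context d (T : measurableType d) (R : realType).
Variables (mu : {sigma_finite_measure set T -> \bar R}) (D : T -> \bar R).
Hypotheses (D0 : forall x, 0 <= D x) (iD : mu.-integrable setT D).

(** The two proofs are arguments because the measure structure is attached to
    this definition and needs them. *)
Definition density_measure of (forall x, 0 <= D x) & mu.-integrable setT D :=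
  fun A : set T => \int[mu]_(x in A) D x.

Local Notation nu := (density_measure D0 iD).

Let nu0 : nu set0 = 0.
Proof. exact: integral_set0. Qed.

Let nu_ge0 A : 0 <= nu A.
Proof. exact: integral_ge0. Qed.

Let nu_sigma_additive : semi_sigma_additive nu.
Proof. by apply: semi_sigma_additive_nng_induced => //; exact: measurable_int iD. Qed.

HB.instance Definition _ := isMeasure.Build _ _ _ nu nu0 nu_ge0 nu_sigma_additive.

Let nu_fin : fin_num_fun nu.
Proof. by move=> A mA; apply: integrable_fin_num => //; exact: integrableS iD. Qed.

HB.instance Definition _ := Measure_isFinite.Build _ _ _ nu nu_fin.

End DensityMeasure.

(** Follows from the change of variables formula for the Radon-Nikodym
    derivative, which agrees with [D] almost everywhere. *)
Lemma ge0_integral_density d (T : measurableType d) (R : realType)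
    (nu : {finite_measure set T -> \bar R})
    (mu : {sigma_finite_measure set T -> \bar R}) (D g : T -> \bar R) :
  (forall x, 0 <= D x) -> mu.-integrable setT D ->
  (forall A, measurable A -> nu A = \int[mu]_(x in A) D x) ->
  measurable_fun setT g -> (forall x, 0 <= g x) ->
  \int[nu]_x g x = \int[mu]_x (g x * D x).
Proof.
move=> D0 iD nuE mg g0; have mD := measurable_int _ iD.
have numu : nu `<< mu.
  apply/null_content_dominatesP => A mA A0.
  rewrite nuE// -(integral_abs_eq0 mA (measurable_funTS mD) A0).
  by apply: eq_integral => x _; rewrite gee0_abs.
rewrite -(@Radon_Nikodym_SigmaFinite.change_of_variables _ _ _ nu mu numu)//.
have fi := Radon_Nikodym_SigmaFinite.f_integrable numu.
apply: ge0_ae_eq_integral => //.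
- by apply: emeasurable_funM => //; exact: measurable_int fi.
- by apply: emeasurable_funM.
- by move=> x _; rewrite mule_ge0// Radon_Nikodym_SigmaFinite.f_ge0.
- by move=> x _; rewrite mule_ge0.
- apply: ae_eqe_mul2l; apply: integral_ae_eq => // A _ mA.
  by rewrite -(Radon_Nikodym_SigmaFinite.f_integral numu)// nuE.
Qed.

(** * The maximal coupling functional *)

Lemma measurable_defect d (T : measurableType d) (R : realType) (f : T -> R) :
  measurable_fun setT f -> measurable_fun setT (fun x => defect (f x)).
Proof. by move=> mf; apply: measurable_maxr => //; exact: measurable_funB. Qed.

Lemma measurable_excess d (T : measurableType d) (R : realType) (f : T -> R) :
  measurable_fun setT f -> measurable_fun setT (fun x => excess (f x)).
Proof. by move=> mf; apply: measurable_maxr => //; exact: measurable_funB. Qed.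

Lemma measurable_ent d (T : measurableType d) (R : realType) (f : T -> R) :
  measurable_fun setT f -> measurable_fun setT (fun x => ent (f x)).
Proof.
move=> mf; apply: measurable_funD => //; apply: measurable_funB => //.
apply: measurable_funM => //; exact: (measurableT_comp (@measurable_ln R)).
Qed.

(** Inversion is a power function on each half-line. *)
Lemma measurable_invr (R : realType) : measurable_fun setT (fun x : R => x^-1)%R.
Proof.
have -> : (fun x : R => x^-1)%R =
  (fun x => if (0 <= x)%R then powR x (-1) else - powR (- x) (-1))%R.
  apply/funext => x; case: ifPn => [x0|]; first by rewrite powR_inv1.
  by rewrite -ltNge => x0; rewrite powR_inv1 ?oppr_ge0 ?ltW// invrN opprK.
apply: measurable_fun_ifT => //=.
- by apply: (@measurable_fun_ler _ _ _ setT (cst 0%R) id).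
- apply: measurableT_comp => //.
  by apply: (measurableT_comp (measurable_powR (-1)%R)) => //; exact: oppr_measurable.
Qed.

Section MaximalCoupling.
Context d (S : measurableType d) (R : realType) (mu : probability S R).

(** Total variation distance between [mu] and [f mu]. *)
Definition tv (f : S -> R) : R := fine (\int[mu]_x (defect (f x))%:E).

(** Expectation of [G (X, Y)] under the maximal coupling of [mu] and [f mu].
    If [tv f = 0] the second term vanishes, as [0^-1 = 0]; the formula is still
    right, for then [defect f = 0] almost everywhere. *)
Definition maxcoup (f : S -> R) (G : S * S -> \bar R) : \bar R :=
  \int[mu]_x ((1 - defect (f x))%:E * G (x, x)) +
  \int[mu]_x \int[mu]_z ((defect (f x) * excess (f z) / tv f)%:E * G (x, z)).

Variable f : S -> R.
Hypotheses (mf : measurable_fun setT f) (f0 : forall x, (0 <= f x)%R)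
  (f1 : \int[mu]_x (f x)%:E = 1).

Let mp := measurable_defect mf.
Let mq := measurable_excess mf.

Lemma integral_defect_le1 : \int[mu]_x (defect (f x))%:E <= 1.
Proof.
rewrite -(@probability_setT _ _ _ mu) -[leRHS]mul1e -integral_cst//.
apply: ge0_le_integral => //.
- by move=> x _; rewrite lee_fin defect_ge0.
- exact/measurable_EFinP.
- by move=> x _; rewrite lee_fin defect_le1.
Qed.

Lemma integral_defect : \int[mu]_x (defect (f x))%:E = (tv f)%:E.
Proof.
rewrite /tv fineK// ge0_fin_numE.
  by apply: (le_lt_trans integral_defect_le1); rewrite ltry.
by apply: integral_ge0 => x _; rewrite lee_fin defect_ge0.
Qed.

Lemma tv_ge0 : (0 <= tv f)%R.
Proof.
rewrite -lee_fin -integral_defect.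
by apply: integral_ge0 => x _; rewrite lee_fin defect_ge0.
Qed.

Lemma integral_excess : \int[mu]_x (excess (f x))%:E = (tv f)%:E.
Proof.
have : \int[mu]_x ((f x)%:E + (defect (f x))%:E) =
       \int[mu]_x (1 + (excess (f x))%:E).
  by apply: eq_integral => x _; rewrite -!EFinD defect_excess.
rewrite !ge0_integralD//.
- rewrite f1 integral_defect integral_cst// mul1e [X in _ = X + _ -> _]probability_setT.
  case: (\int[mu]_x (excess (f x))%:E) => [r| |]//=.
  by rewrite -!EFinD => -[/addrI ->].
- by move=> x _; rewrite lee_fin excess_ge0.
- exact/measurable_EFinP.
- by move=> x _; rewrite lee_fin f0.
- exact/measurable_EFinP.
- by move=> x _; rewrite lee_fin defect_ge0.
- exact/measurable_EFinP.
Qed.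

(** Makes the division by [tv f] harmless: [t / t] is 1, or else the weight [w]
    vanishes almost everywhere. *)
Lemma integral_mass_cancel (w : S -> R) (t : R) (g : S -> \bar R) :
  measurable_fun setT w -> (forall x, (0 <= w x)%R) ->
  \int[mu]_x (w x)%:E = t%:E ->
  measurable_fun setT g -> (forall x, 0 <= g x) ->
  (t / t)%:E * \int[mu]_x ((w x)%:E * g x) = \int[mu]_x ((w x)%:E * g x).
Proof.
move=> mw w0 wt mg g0; have [t0|t0] := eqVneq t 0%R; last first.
  by rewrite divff// mul1e.
rewrite t0 mul0r mul0e; symmetry.
have : ae_eq mu setT (EFin \o w) (cst 0).
  apply/ae_eq_integral_abs => //; first exact/measurable_EFinP.
  rewrite -[RHS]/(0%R%:E) -t0 -wt; apply: eq_integral => x _.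
  by rewrite /= ger0_norm.
move=> w0ae; rewrite (ge0_ae_eq_integral (g := cst 0)) ?integral0//.
- by apply: emeasurable_funM => //; exact/measurable_EFinP.
- by move=> x _; rewrite mule_ge0// lee_fin.
- by apply: filterS w0ae => x /= /(_ I) -> _; rewrite mul0e.
Qed.

Lemma maxcoup_ge0 (G : S * S -> \bar R) : (forall u, 0 <= G u) -> 0 <= maxcoup f G.
Proof.
move=> G0; rewrite adde_ge0// integral_ge0// => x _.
  by rewrite mule_ge0// lee_fin subr_ge0 defect_le1.
apply: integral_ge0 => z _; rewrite mule_ge0// lee_fin.
by rewrite divr_ge0 ?mulr_ge0 ?defect_ge0 ?excess_ge0// tv_ge0.
Qed.

(** The next two lemmas say that the marginals of the maximal coupling are
    [mu] and [f mu]: the factor of total mass [tv f] integrates out, and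
    [(1 - defect f) + defect f = 1], [(1 - defect f) + excess f = f]. *)
Lemma maxcoup_fst (g : S -> \bar R) :
  measurable_fun setT g -> (forall x, 0 <= g x) ->
  maxcoup f (fun xz => g xz.1) = \int[mu]_x g x.
Proof.
move=> mg g0; rewrite /maxcoup /=.
have -> : \int[mu]_x \int[mu]_z ((defect (f x) * excess (f z) / tv f)%:E * g x) =
  \int[mu]_x ((defect (f x))%:E * g x).
  transitivity (\int[mu]_x ((tv f / tv f)%:E * ((defect (f x))%:E * g x))).
    apply: eq_integral => x _.
    under eq_integral do rewrite mulrAC EFinM muleAC.
    rewrite ge0_integralZl//.
    - rewrite integral_excess muleAC -EFinM muleA -EFinM.
      by congr (_%:E * _); ring.
    - exact/measurable_EFinP.
    - by move=> z _; rewrite lee_fin excess_ge0.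
    - by rewrite mule_ge0// lee_fin divr_ge0 ?defect_ge0// tv_ge0.
  rewrite ge0_integralZl//.
  - apply: integral_mass_cancel => //; last exact: integral_defect.
    by move=> x; rewrite defect_ge0.
  - by apply: emeasurable_funM => //; exact/measurable_EFinP.
  - by move=> x _; rewrite mule_ge0// lee_fin defect_ge0.
  - by rewrite lee_fin divr_ge0// tv_ge0.
rewrite -ge0_integralD//.
- apply: eq_integral => x _; rewrite -ge0_muleDl ?lee_fin ?subr_ge0 ?defect_le1 ?defect_ge0//.
  by rewrite -EFinD subrK mul1e.
- by move=> x _; rewrite mule_ge0// lee_fin subr_ge0 defect_le1.
- by apply: emeasurable_funM => //; apply/measurable_EFinP; exact: measurable_funB.
- by move=> x _; rewrite mule_ge0// lee_fin defect_ge0.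
- by apply: emeasurable_funM => //; exact/measurable_EFinP.
Qed.

Lemma maxcoup_snd (g : S -> \bar R) :
  measurable_fun setT g -> (forall x, 0 <= g x) ->
  maxcoup f (fun xz => g xz.2) = \int[mu]_x ((f x)%:E * g x).
Proof.
move=> mg g0; rewrite /maxcoup /=.
have mqg : measurable_fun setT (fun x => (excess (f x))%:E * g x).
  by apply: emeasurable_funM => //; exact/measurable_EFinP.
have qg0 x : 0 <= (excess (f x))%:E * g x by rewrite mule_ge0// lee_fin excess_ge0.
have -> : \int[mu]_x \int[mu]_z ((defect (f x) * excess (f z) / tv f)%:E * g z) =
  \int[mu]_x ((excess (f x))%:E * g x).
  have A0 : 0 <= \int[mu]_z ((excess (f z))%:E * g z) by exact: integral_ge0.
  transitivity (\int[mu]_x ((defect (f x))%:E *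
      ((tv f)^-1%:E * \int[mu]_z ((excess (f z))%:E * g z)))).
    apply: eq_integral => x _.
    under eq_integral do rewrite mulrAC EFinM -muleA.
    rewrite ge0_integralZl//; first by rewrite EFinM -muleA.
    by rewrite lee_fin divr_ge0 ?defect_ge0// tv_ge0.
  rewrite ge0_integralZr//.
  - rewrite integral_defect muleA -EFinM.
    apply: integral_mass_cancel => //; last exact: integral_excess.
    by move=> x; rewrite excess_ge0.
  - exact/measurable_EFinP.
  - by move=> x _; rewrite lee_fin defect_ge0.
  - by rewrite mule_ge0// lee_fin invr_ge0 tv_ge0.
rewrite -ge0_integralD//.
- apply: eq_integral => x _.
  rewrite -ge0_muleDl ?lee_fin ?subr_ge0 ?defect_le1 ?excess_ge0//.
  by rewrite -EFinD; congr (_%:E * _); have := defect_excess (f x); lra.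
- by move=> x _; rewrite mule_ge0// lee_fin subr_ge0 defect_le1.
- by apply: emeasurable_funM => //; apply/measurable_EFinP; exact: measurable_funB.
Qed.

End MaximalCoupling.

(** * The maximal coupling as a measure, with a parameter *)

Section CouplingMeasure.
Context d d' (W : measurableType d) (S : measurableType d') (R : realType).
Variables (Pr : probability W R) (mu : probability S R) (f : W * S -> R).
Hypotheses (mf : measurable_fun setT f) (f0 : forall u, (0 <= f u)%R)
  (f1 : forall w, \int[mu]_x (f (w, x))%:E = 1).

Let mfw w : measurable_fun setT (fun x => f (w, x)).
Proof. by apply: (measurableT_comp mf); exact: pair1_measurable. Qed.

Lemma measurable_tv : measurable_fun setT (fun w => tv mu (fun x => f (w, x))).
Proof.
apply: (measurableT_comp (@fine_measurable R setT measurableT)).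
apply: (@measurable_fun_fubini_tonelli_F _ _ _ _ _ mu (fun u => (defect (f u))%:E)).
  by apply/measurable_EFinP; exact: measurable_defect.
by move=> u; rewrite lee_fin defect_ge0.
Qed.

Local Notation mu2 := (mu \x mu : probability (S * S)%type R).

(** The joint law on [W * (S * S)] will be the sum of the image under
    [diag_embed] of a measure with density [agree_density], where [X = Y], and of
    a measure with density [differ_density]. *)
Definition diag_embed (u : W * S) : W * (S * S) := (u.1, (u.2, u.2)).
Definition agree_density (u : W * S) := (1 - defect (f u))%:E.
Definition differ_density (u : W * (S * S)) :=
  (defect (f (u.1, u.2.1)) * excess (f (u.1, u.2.2)) /
    tv mu (fun x => f (u.1, x)))%:E.

Let D10 u : 0 <= agree_density u. Proof. by rewrite lee_fin subr_ge0 defect_le1. Qed.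

Let D20 u : 0 <= differ_density u.
Proof.
rewrite lee_fin divr_ge0 ?mulr_ge0 ?defect_ge0 ?excess_ge0//.
exact: tv_ge0.
Qed.

Let mD1 : measurable_fun setT agree_density.
Proof.
apply/measurable_EFinP; apply: measurable_funB => //; exact: measurable_defect.
Qed.

Let mD2 : measurable_fun setT differ_density.
Proof.
have m1 : measurable_fun setT (fun u : W * (S * S) => (u.1, u.2.1)).
  apply: measurable_fun_pair => //; exact: measurableT_comp.
have m2 : measurable_fun setT (fun u : W * (S * S) => (u.1, u.2.2)).
  apply: measurable_fun_pair => //; exact: measurableT_comp.
apply/measurable_EFinP; apply: measurable_funM.
  apply: measurable_funM.
    by apply: measurable_defect; exact: measurableT_comp mf m1.
  by apply: measurable_excess; exact: measurableT_comp mf m2.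
apply: (measurableT_comp (@measurable_invr R)).
exact: (measurableT_comp measurable_tv).
Qed.

Let mdiag : measurable_fun setT diag_embed.
Proof. apply: measurable_fun_pair => //; exact: measurable_fun_pair. Qed.

Section Integrand.
Variable G : W * (S * S) -> \bar R.
Hypotheses (mG : measurable_fun setT G) (G0 : forall u, 0 <= G u).

Let h1 : measurable_fun setT (fun u => G (diag_embed u) * agree_density u).
Proof. by apply: emeasurable_funM => //; exact: measurableT_comp. Qed.
Let h2 : measurable_fun setT (fun u => G u * differ_density u).
Proof. exact: emeasurable_funM. Qed.
Let h10 u : 0 <= G (diag_embed u) * agree_density u. Proof. by rewrite mule_ge0. Qed.
Let h20 u : 0 <= G u * differ_density u. Proof. by rewrite mule_ge0. Qed.

Let maxcoupE w : maxcoup mu (fun x => f (w, x)) (fun xz => G (w, xz)) =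
  fubini_F mu (fun u => G (diag_embed u) * agree_density u) w +
  fubini_F mu2 (fun u => G u * differ_density u) w.
Proof.
rewrite /maxcoup; congr (_ + _).
  by apply: eq_integral => x _; rewrite muleC.
transitivity (\int[mu]_x \int[mu]_z (G (w, (x, z)) * differ_density (w, (x, z)))).
  by apply: eq_integral => x _; apply: eq_integral => z _; rewrite muleC.
symmetry; apply: (fubini_tonelli1 (m1 := mu) (m2 := mu)
  (fun xz => G (w, xz) * differ_density (w, xz))) => //.
by apply: (measurableT_comp h2); exact: pair1_measurable.
Qed.

Lemma measurable_maxcoup : measurable_fun setT
  (fun w => maxcoup mu (fun x => f (w, x)) (fun xz => G (w, xz))).
Proof.
under eq_fun do rewrite maxcoupE.
by apply: emeasurable_funD; exact: measurable_fun_fubini_tonelli_F.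
Qed.

Lemma integral_maxcoup :
  \int[Pr \x mu]_u (G (diag_embed u) * agree_density u) +
  \int[Pr \x mu2]_u (G u * differ_density u) =
  \int[Pr]_w maxcoup mu (fun x => f (w, x)) (fun xz => G (w, xz)).
Proof.
rewrite (fubini_tonelli1 (fun u => G (diag_embed u) * agree_density u))//.
rewrite (fubini_tonelli1 (fun u => G u * differ_density u))// -ge0_integralD//.
- by apply: eq_integral => w _; rewrite maxcoupE.
- by move=> w _; apply: integral_ge0.
- exact: measurable_fun_fubini_tonelli_F.
- by move=> w _; apply: integral_ge0.
- exact: measurable_fun_fubini_tonelli_F.
Qed.

End Integrand.

(** Given [w] of law [Pr], the added pair is a maximal coupling of [mu] and
    [f(w, .) mu]. The parameter [w] carries the part of the coupling that is
    already there. *)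
Lemma exists_maximal_coupling : exists Pr' : probability (W * (S * S))%type R,
  forall G : W * (S * S) -> \bar R, measurable_fun setT G -> (forall u, 0 <= G u) ->
  \int[Pr']_u G u =
  \int[Pr]_w maxcoup mu (fun x => f (w, x)) (fun xz => G (w, xz)).
Proof.
pose P1 : probability (W * S)%type R := Pr \x mu.
pose P2 : probability (W * (S * S))%type R := Pr \x mu2.
have total1 : \int[P1]_u agree_density u + \int[P2]_u differ_density u = 1.
  have := @integral_maxcoup (cst 1) (measurable_cst _) (fun=> lee01).
  under eq_integral do rewrite mul1e.
  under [X in _ + X]eq_integral do rewrite mul1e.
  move=> ->; transitivity (\int[Pr]_w (cst 1 w)).
    apply: eq_integral => w _.
    rewrite (@maxcoup_fst _ _ _ mu (fun x => f (w, x)) (mfw w) _ _ (cst 1))//.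
    by rewrite integral_cst//= mul1e probability_setT.
  by rewrite integral_cst//= mul1e probability_setT.
have I1 : \int[P1]_u agree_density u < +oo.
  rewrite (@le_lt_trans _ _ 1) ?ltry// -total1 leeDl//; exact: integral_ge0.
have I2 : \int[P2]_u differ_density u < +oo.
  rewrite (@le_lt_trans _ _ 1) ?ltry// -total1 leeDr//; exact: integral_ge0.
have i1 : P1.-integrable setT agree_density.
  apply/integrableP; split => //.
  by under eq_integral do rewrite gee0_abs//.
have i2 : P2.-integrable setT differ_density.
  apply/integrableP; split => //.
  by under eq_integral do rewrite gee0_abs//.
pose n1 := density_measure D10 i1.
pose n2 := density_measure D20 i2.
pose m0 := measure_add (pushforward n1 diag_embed) n2.
pose m := m0 mdiag.
have mE (G : W * (S * S) -> \bar R) : measurable_fun setT G -> (forall u, 0 <= G u) ->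
    \int[m]_u G u = \int[Pr]_w maxcoup mu (fun x => f (w, x)) (fun xz => G (w, xz)).
  move=> mG G0; rewrite -integral_maxcoup//.
  rewrite ge0_integral_measure_add//; congr (_ + _).
    rewrite ge0_integral_pushforward//.
    rewrite (ge0_integral_density D10 i1)//.
      exact: (measurableT_comp mG mdiag).
    by move=> u; exact: G0.
  by rewrite (ge0_integral_density D20 i2).
have m_1 : m setT = 1.
  rewrite -[LHS]mul1e -integral_cst//.
  by rewrite mE// -integral_maxcoup//; under eq_integral do rewrite mul1e;
    under [X in _ + X]eq_integral do rewrite mul1e.
have [P PE] := probability_of_measure (dirac point) m_1.
exists P => G mG G0; rewrite -mE//.
by apply: eq_measure_integral => A mA _; exact: PE.
Qed.

End CouplingMeasure.

(** * Transport costs of the maximal coupling *)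

Section IntegralBounds.
Context d (S : measurableType d) (R : realType) (mu : probability S R).

(** A zero coefficient stands for a missing term. *)
Lemma le_integral_combination3 (u v1 v2 v3 : S -> R) (a1 a2 a3 : R) :
  measurable_fun setT u -> measurable_fun setT v1 ->
  measurable_fun setT v2 -> measurable_fun setT v3 ->
  (forall x, (0 <= u x)%R) -> (forall x, (0 <= v1 x)%R) ->
  (forall x, (0 <= v2 x)%R) -> (forall x, (0 <= v3 x)%R) ->
  (0 <= a1)%R -> (0 <= a2)%R -> (0 <= a3)%R ->
  (forall x, (u x <= a1 * v1 x + a2 * v2 x + a3 * v3 x)%R) ->
  \int[mu]_x (u x)%:E <= a1%:E * \int[mu]_x (v1 x)%:E +
    a2%:E * \int[mu]_x (v2 x)%:E + a3%:E * \int[mu]_x (v3 x)%:E.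
Proof.
move=> mu0 m1 m2 m3 u0 v10 v20 v30 a10 a20 a30 uv.
rewrite -!ge0_integralZl//; try (by apply/measurable_EFinP); try (by move=> x _; rewrite lee_fin).
have h1 : measurable_fun setT (fun x => a1%:E * (v1 x)%:E).
  by apply/measurable_EFinP; exact: measurable_funM.
have h2 : measurable_fun setT (fun x => a2%:E * (v2 x)%:E).
  by apply/measurable_EFinP; exact: measurable_funM.
have h3 : measurable_fun setT (fun x => a3%:E * (v3 x)%:E).
  by apply/measurable_EFinP; exact: measurable_funM.
have n1 x : setT x -> 0 <= a1%:E * (v1 x)%:E by move=> _; rewrite -EFinM lee_fin mulr_ge0.
have n2 x : setT x -> 0 <= a2%:E * (v2 x)%:E by move=> _; rewrite -EFinM lee_fin mulr_ge0.
have n3 x : setT x -> 0 <= a3%:E * (v3 x)%:E by move=> _; rewrite -EFinM lee_fin mulr_ge0.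
have h12 := emeasurable_funD h1 h2.
have n12 x : setT x -> 0 <= a1%:E * (v1 x)%:E + a2%:E * (v2 x)%:E.
  by move=> _; rewrite adde_ge0 ?n1 ?n2.
rewrite -ge0_integralD// -ge0_integralD//.
apply: ge0_le_integral => //.
- by move=> x _; rewrite lee_fin.
- exact/measurable_EFinP.
- by do 2 apply: emeasurable_funD => //.
- by move=> x _; rewrite -!EFinM -!EFinD lee_fin.
Qed.

(** [w / t] is a probability density that integrates out ([w] is [excess f] on
    the [X] side and [defect f] on the [Y] side). In the second term the weight
    [b] sits at the independent point [z], so that the double integral factors. *)
Lemma le_integral_two_terms (J : S * S -> R) (A V w b : S -> R) (t v : R) :
  measurable_fun setT J -> measurable_fun setT A -> measurable_fun setT V ->
  measurable_fun setT w -> measurable_fun setT b ->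
  (forall u, (0 <= J u)%R) -> (forall x, (0 <= A x)%R) ->
  (forall x, (0 <= V x)%R) -> (forall x, (0 <= w x)%R) -> (forall x, (0 <= b x)%R) ->
  \int[mu]_x (w x)%:E = t%:E -> \int[mu]_x (V x)%:E = v%:E ->
  (forall x z, J (x, z) <= w z / t * A x + V x / t * (w z * b z))%R ->
  \int[mu]_x \int[mu]_z (J (x, z))%:E <=
    \int[mu]_x (A x)%:E + (v / t)%:E * \int[mu]_z (w z * b z)%:E.
Proof.
move=> mJ mA mV mw mb J0 A0 V0 w0 b0 wt Vv JAV.
have t0 : (0 <= t)%R.
  by rewrite -lee_fin -wt; apply: integral_ge0 => x _; rewrite lee_fin.
have ti0 : (0 <= t^-1)%R by rewrite invr_ge0.
have tt : (t / t <= 1)%R.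
  by have [->|] := eqVneq t 0%R; [rewrite mul0r|move=> ?; rewrite divff].
set B := \int[mu]_z (w z * b z)%:E.
have mwb : measurable_fun setT (fun z => (w z * b z)%R) by exact: measurable_funM.
have B0 : 0 <= B by apply: integral_ge0 => z _; rewrite lee_fin mulr_ge0.
have inner x : \int[mu]_z (J (x, z))%:E <= (A x)%:E + (V x)%:E * (t^-1%:E * B).
  have := @le_integral_combination3 (fun z => J (x, z)) w (fun z => (w z * b z)%R) w
    (A x / t) (V x / t) 0.
  rewrite mul0e adde0 wt => le3; apply: (le_trans (le3 _ _ _ _ _ _ _ _ _ _ _ _)) => //.
  - by apply: (measurableT_comp mJ); exact: pair1_measurable.
  - by move=> z; rewrite mulr_ge0.
  - by rewrite mulr_ge0.
  - by rewrite mulr_ge0.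
  - by move=> z; rewrite mul0r addr0; have := JAV x z; nra.
  - apply: leeD; last by rewrite muleA.
    by rewrite -EFinM lee_fin mulrAC -mulrA ler_piMr.
have mF : measurable_fun setT (fun x => \int[mu]_z (J (x, z))%:E).
  apply: (@measurable_fun_fubini_tonelli_F _ _ _ _ _ mu (fun u => (J u)%:E)) => //.
  exact/measurable_EFinP.
have tB0 : 0 <= t^-1%:E * B by rewrite mule_ge0.
have mVB : measurable_fun setT (fun x => (V x)%:E * (t^-1%:E * B)).
  by apply: emeasurable_funM => //; exact/measurable_EFinP.
apply: (@le_trans _ _ (\int[mu]_x ((A x)%:E + (V x)%:E * (t^-1%:E * B)))).
  apply: ge0_le_integral => //.
  - by move=> x _; apply: integral_ge0 => z _; rewrite lee_fin.
  - by apply: emeasurable_funD => //; exact/measurable_EFinP.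
rewrite ge0_integralD//.
- rewrite leeD2l// ge0_integralZr//.
  + by rewrite Vv EFinM muleA.
  + exact/measurable_EFinP.
  + by move=> x _; rewrite lee_fin.
- by move=> x _; rewrite lee_fin.
- exact/measurable_EFinP.
- by move=> x _; rewrite mule_ge0// lee_fin.
Qed.

(** [b] stands for the square of the coordinate divided by [K ^ 2]; [h] is the
    entropy of [f mu]. *)
Variables (f b : S -> R) (h : R).
Hypotheses (mf : measurable_fun setT f) (f0 : forall x, (0 <= f x)%R)
  (f1 : \int[mu]_x (f x)%:E = 1)
  (mb : measurable_fun setT b) (b0 : forall x, (0 <= b x)%R)
  (psib : \int[mu]_x (expR (b x))%:E <= 2%:E)
  (hE : \int[mu]_x (ent (f x))%:E = h%:E).

Let p x := defect (f x).
Let q x := excess (f x).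
Let g x := chi (f x).
Let t := tv mu f.
Let p0 x : (0 <= p x)%R. Proof. exact: defect_ge0. Qed.
Let q0 x : (0 <= q x)%R. Proof. exact: excess_ge0. Qed.
Let g0 x : (0 <= g x)%R. Proof. exact: chi_ge0. Qed.
Let e0 x : (0 <= ent (f x))%R. Proof. exact: ent_ge0. Qed.
Let mp : measurable_fun setT p. Proof. exact: measurable_defect. Qed.
Let mq : measurable_fun setT q. Proof. exact: measurable_excess. Qed.
Let me : measurable_fun setT (fun x => ent (f x)). Proof. exact: measurable_ent. Qed.
Let mg : measurable_fun setT g.
Proof.
apply: measurable_funM; first exact: measurable_funX.
exact: (measurableT_comp (@measurable_invr R)).
Qed.
Let mexp : measurable_fun setT (fun x => expR (b x)).
Proof. exact: (measurableT_comp (@measurable_expR R)). Qed.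
Let exp0 x : (0 <= expR (b x))%R. Proof. exact: expR_ge0. Qed.
Let t0 : (0 <= t)%R. Proof. exact: tv_ge0. Qed.

Lemma integral_ent_ge0 : (0 <= h)%R.
Proof. by rewrite -lee_fin -hE; apply: integral_ge0 => x _; rewrite lee_fin. Qed.

Let psib' s : (0 <= s)%R -> s%:E * \int[mu]_x (expR (b x))%:E <= (2 * s)%:E.
Proof.
by move=> s0; rewrite (le_trans (lee_wpmul2l _ psib))// -EFinM mulrC.
Qed.

Lemma integral_sqr_defect_weighted L : (0 <= L)%R ->
  \int[mu]_x (p x ^+ 2 * b x)%:E <= (4 * L * h + 2 * expR (- L))%:E.
Proof.
move=> L0.
have := @le_integral_combination3 (fun x => p x ^+ 2 * b x)%R (fun x => ent (f x))
  (fun x => expR (b x)) b (4 * L) (expR (- L)) 0.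
rewrite mul0e adde0 hE => le3; apply: (le_trans (le3 _ _ _ _ _ _ _ _ _ _ _ _)) => //.
- by apply: measurable_funM => //; exact: measurable_funX.
- by move=> x; rewrite mulr_ge0// sqr_ge0.
- by rewrite mulr_ge0.
- by move=> x; rewrite mul0r addr0; apply: sqr_defect_young.
- by rewrite [leRHS]EFinD leeD// psib'// expR_ge0.
Qed.

Lemma integral_chi_weighted L : (0 <= L)%R ->
  \int[mu]_x (g x * b x)%:E <= ((4 * L + 9) * h + 2 * expR (- L))%:E.
Proof.
move=> L0.
have := @le_integral_combination3 (fun x => g x * b x)%R (fun x => ent (f x))
  (fun x => expR (b x)) b (4 * L + 9) (expR (- L)) 0.
rewrite mul0e adde0 hE => le3; apply: (le_trans (le3 _ _ _ _ _ _ _ _ _ _ _ _)) => //.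
- by apply: measurable_funM.
- by move=> x; rewrite mulr_ge0.
- by rewrite addr_ge0// mulr_ge0.
- by move=> x; rewrite mul0r addr0; apply: chi_young.
- by rewrite [leRHS]EFinD leeD// psib'// expR_ge0.
Qed.

Lemma integral_defect_weighted L : (0 <= L)%R ->
  \int[mu]_x (p x * b x)%:E <= (L * t + 2 * expR (- L))%:E.
Proof.
move=> L0.
have := @le_integral_combination3 (fun x => p x * b x)%R p
  (fun x => expR (b x)) b L (expR (- L)) 0.
rewrite mul0e adde0 (integral_defect mu mf f0).
move=> le3; apply: (le_trans (le3 _ _ _ _ _ _ _ _ _ _ _ _)) => //.
- by apply: measurable_funM.
- by move=> x; rewrite mulr_ge0.
- by move=> x; rewrite mul0r addr0; apply: defect_young.
- by rewrite [leRHS]EFinD leeD// psib'// expR_ge0.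
Qed.

Lemma integral_excess_weighted L : (0 <= L)%R ->
  \int[mu]_x (q x * b x)%:E <= ((L + 1) * t + h + 2 * expR (- L))%:E.
Proof.
move=> L0.
have := @le_integral_combination3 (fun x => q x * b x)%R q (fun x => ent (f x))
  (fun x => expR (b x)) (L + 1) 1 (expR (- L)).
rewrite mul1e hE (integral_excess mf f0 f1).
move=> le3; apply: (le_trans (le3 _ _ _ _ _ _ _ _ _ _ _ _)) => //.
- by apply: measurable_funM.
- by move=> x; rewrite mulr_ge0.
- by rewrite addr_ge0.
- by move=> x; rewrite mul1r; apply: excess_young.
- by rewrite [leRHS]EFinD leeD// psib'// expR_ge0.
Qed.

Lemma integral_defect_am_gm r : (0 < r)%R ->
  \int[mu]_x (p x * b x)%:E <= (2 / r * h + 2 * r)%:E.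
Proof.
move=> r0.
have := @le_integral_combination3 (fun x => p x * b x)%R (fun x => ent (f x))
  (fun x => expR (b x)) b (2 / r) r 0.
rewrite mul0e adde0 hE => le3; apply: (le_trans (le3 _ _ _ _ _ _ _ _ _ _ _ _)) => //.
- by apply: measurable_funM.
- by move=> x; rewrite mulr_ge0.
- by rewrite divr_ge0// ltW.
- exact: ltW.
- by move=> x; rewrite mul0r addr0; apply: defect_am_gm.
- by rewrite [leRHS]EFinD leeD// psib'// ltW.
Qed.

Lemma integral_excess_am_gm r : (0 < r)%R ->
  \int[mu]_x (q x * b x)%:E <= ((8 / r + 9) * h + 2 * r)%:E.
Proof.
move=> r0.
have := @le_integral_combination3 (fun x => q x * b x)%R (fun x => ent (f x))
  (fun x => expR (b x)) b (8 / r + 9) r 0.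
rewrite mul0e adde0 hE => le3; apply: (le_trans (le3 _ _ _ _ _ _ _ _ _ _ _ _)) => //.
- by apply: measurable_funM.
- by move=> x; rewrite mulr_ge0.
- by rewrite addr_ge0// divr_ge0// ltW.
- exact: ltW.
- by move=> x; rewrite mul0r addr0; apply: excess_am_gm.
- by rewrite [leRHS]EFinD leeD// psib'// ltW.
Qed.

(** [V] is [defect f ^ 2] or [chi f], and [v / t] multiplies a bound that has one
    term of order [t] and one of order [h]. The bound [v <= 4 h] serves for the
    former, and [v <= t] for the latter. *)
Lemma integral_small_weight (V : S -> R) :
  measurable_fun setT V -> (forall x, (0 <= V x)%R) ->
  \int[mu]_x (V x)%:E <= t%:E -> (forall x, (V x <= 4 * ent (f x))%R) ->
  exists v : R, [/\ \int[mu]_x (V x)%:E = v%:E, (0 <= v)%R, (v <= t)%R & (v <= 4 * h)%R].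
Proof.
move=> mV V0 le1 Ve.
have le2 : \int[mu]_x (V x)%:E <= (4 * h)%:E.
  rewrite EFinM -hE -ge0_integralZl//.
  - apply: ge0_le_integral => //.
    + by move=> x _; rewrite lee_fin.
    + exact/measurable_EFinP.
    + by apply/measurable_EFinP; exact: measurable_funM.
    + by move=> x _; rewrite -EFinM lee_fin.
  - exact/measurable_EFinP.
  - by move=> x _; rewrite lee_fin.
have ge0 : 0 <= \int[mu]_x (V x)%:E by apply: integral_ge0 => x _; rewrite lee_fin.
exists (fine (\int[mu]_x (V x)%:E)).
have fin : \int[mu]_x (V x)%:E \is a fin_num.
  by rewrite ge0_fin_numE// (le_lt_trans le1)// ltry.
by split; rewrite -?lee_fin fineK.
Qed.

(** The estimate common to both weak costs. With [v] the mass of [V], the term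
    in [V b] is of order [(1 + L) h + exp (- L)] already, and the decoupled term
    is [v / t] times [(L + 1) t + h + 2 exp (- L)], which is of the same order
    since [v <= 4 h] and [v / t <= 1]. *)
Lemma weak_cost_bound (J : S * S -> R) (V w F : S -> R) (k L : R) :
  (0 <= k)%R -> (0 <= L)%R ->
  measurable_fun setT J -> (forall u, (0 <= J u)%R) ->
  measurable_fun setT V -> (forall x, (0 <= V x)%R) ->
  measurable_fun setT w -> (forall x, (0 <= w x)%R) ->
  measurable_fun setT F -> (forall x, (0 <= F x)%R) ->
  \int[mu]_x (w x)%:E = t%:E ->
  \int[mu]_x (V x)%:E <= t%:E -> (forall x, (V x <= 4 * ent (f x))%R) ->
  \int[mu]_x (w x * b x)%:E <= ((L + 1) * t + h + 2 * expR (- L))%:E ->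
  \int[mu]_x (V x * b x)%:E <= ((4 * L + 9) * h + 2 * expR (- L))%:E ->
  (forall x z, J (x, z) <= w z / t * (2 * k * V x * b x + F x) +
     2 * k * V x / t * (w z * b z))%R ->
  \int[mu]_x \int[mu]_z (J (x, z))%:E <=
    (28 * k * ((1 + L) * h + expR (- L)))%:E + \int[mu]_x (F x)%:E.
Proof.
move=> k0 L0 mJ J0 mV V0 mw w0 mF F0 wt Vt Ve wb Vb JVw.
have [v [vE v0 vt vh]] := integral_small_weight mV V0 Vt Ve.
have h0 := integral_ent_ge0.
have s0 := expR_ge0 (- L).
have k2 : (0 <= 2 * k)%R by rewrite mulr_ge0.
have mVb : measurable_fun setT (fun x => 2 * k * V x * b x)%R.
  by do 2 apply: measurable_funM => //.
have Vb0 x : (0 <= 2 * k * V x * b x)%R by rewrite !mulr_ge0.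
have := @le_integral_two_terms J (fun x => 2 * k * V x * b x + F x)%R
  (fun x => 2 * k * V x)%R w b t (2 * k * v).
move=> two; apply: (le_trans (two _ _ _ _ _ _ _ _ _ _ _ _ _)) => //.
- exact: measurable_funD.
- exact: measurable_funM.
- by move=> x; rewrite addr_ge0.
- by move=> x; rewrite mulr_ge0.
- under eq_integral do rewrite EFinM.
  rewrite ge0_integralZl//; first by rewrite vE.
  + exact/measurable_EFinP.
  + by move=> x _; rewrite lee_fin.
under eq_integral do rewrite EFinD.
rewrite ge0_integralD//; last 4 first.
- by move=> x _; rewrite lee_fin.
- exact/measurable_EFinP.
- by move=> x _; rewrite lee_fin.
- exact/measurable_EFinP.
rewrite addeAC leeD2r//.
under eq_integral do rewrite -mulrA EFinM.
rewrite ge0_integralZl//; last 2 first.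
- by apply/measurable_EFinP; exact: measurable_funM.
- by move=> x _; rewrite lee_fin mulr_ge0.
apply: (le_trans (leeD (lee_wpmul2l _ Vb) (lee_wpmul2l _ wb))).
- by rewrite lee_fin.
- by rewrite lee_fin divr_ge0// mulr_ge0.
rewrite -!EFinM -EFinD lee_fin.
set s := expR (- L) in s0 *.
have vt1 : (v / t * t <= v)%R.
  have [->|tn0] := eqVneq t 0%R; first by rewrite mulr0.
  by rewrite divfK.
have vt2 : (v / t <= 1)%R.
  have [->|tn0] := eqVneq t 0%R; first by rewrite invr0 mulr0.
  by rewrite ler_pdivrMr ?mul1r// lt_neqAle eq_sym tn0.
have vt0 : (0 <= v / t)%R by rewrite divr_ge0.
have -> : (2 * k * v / t = 2 * k * (v / t))%R by rewrite mulrA.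
have : (v / t * ((L + 1) * t + h + 2 * s) <= 4 * (L + 1) * h + h + 2 * s)%R.
  have h1 : ((L + 1) * (v / t * t) <= (L + 1) * (4 * h))%R.
    by rewrite ler_wpM2l ?addr_ge0// (le_trans vt1).
  have h2 : (v / t * (h + 2 * s) <= h + 2 * s)%R.
    by rewrite ler_piMl// addr_ge0// mulr_ge0.
  lra.
move=> /(ler_wpM2l k2).
have Lh : (0 <= k * (L * h))%R by rewrite !mulr_ge0.
have kh : (0 <= k * h)%R by rewrite mulr_ge0.
have ks : (0 <= k * s)%R by rewrite mulr_ge0.
lra.
Qed.

(** [c] stands for the distance between the coordinates. It vanishes on the diagonal, so
    the part of the coupling where [X = Y] contributes nothing. *)
Section Cost.
Variables (c : S * S -> R) (k : R).
Hypotheses (mc : measurable_fun setT c) (c0 : forall u, (0 <= c u)%R)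
  (cxx : forall x, c (x, x) = 0%R) (k0 : (0 <= k)%R)
  (cb : forall x z, (c (x, z) ^+ 2 <= 2 * k * (b x + b z))%R).

Let m1 (u : S -> R) : measurable_fun setT u ->
  measurable_fun setT (fun xz : S * S => u xz.1).
Proof. by move=> mu0; exact: measurableT_comp. Qed.
Let m2 (u : S -> R) : measurable_fun setT u ->
  measurable_fun setT (fun xz : S * S => u xz.2).
Proof. by move=> mu0; exact: measurableT_comp. Qed.

Let ti0 : (0 <= t^-1)%R. Proof. by rewrite invr_ge0. Qed.

Let diag0 (G : S * S -> R) : (forall x, G (x, x) = 0%R) ->
  maxcoup mu f (EFin \o G) =
  \int[mu]_x \int[mu]_z (p x * q z / t * G (x, z))%:E.
Proof.
move=> G0; rewrite /maxcoup /= (eq_integral (cst 0)) ?integral0 ?add0e//.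
by move=> x _; rewrite G0 mule0.
Qed.

(** Dual form of the bound on E(E(c | X)^2), obtained pointwise from
    [2 (defect f * c) phi <= (defect f * c) ^ 2 + phi ^ 2]. *)
Lemma maxcoup_weak_fst (phi : S -> R) (L : R) : (0 <= L)%R ->
  measurable_fun setT phi -> (forall x, (0 <= phi x)%R) ->
  maxcoup mu f (fun xz => (2 * c xz * phi xz.1)%:E) <=
    (28 * k * ((1 + L) * h + expR (- L)))%:E + \int[mu]_x (phi x ^+ 2)%:E.
Proof.
move=> L0 mphi phi0.
rewrite (diag0 (G := fun xz => 2 * c xz * phi xz.1)%R); last first.
  by move=> x; rewrite cxx mulr0 mul0r.
apply: (@weak_cost_bound (fun xz => p xz.1 * q xz.2 / t * (2 * c xz * phi xz.1))%R
  (fun x => p x ^+ 2)%R q (fun x => phi x ^+ 2)%R) => //.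
- apply: measurable_funM.
    by do 2 apply: measurable_funM => //; [exact: m1|exact: m2].
  apply: measurable_funM; last exact: m1.
  exact: measurable_funM.
- by move=> u; rewrite !mulr_ge0.
- exact: measurable_funX.
- by move=> x; rewrite sqr_ge0.
- exact: measurable_funX.
- by move=> x; rewrite sqr_ge0.
- exact: integral_excess.
- rewrite -(integral_defect mu mf f0); apply: ge0_le_integral => //.
  + by move=> x _; rewrite lee_fin sqr_ge0.
  + by apply/measurable_EFinP; exact: measurable_funX.
  + exact/measurable_EFinP.
  + by move=> x _; rewrite lee_fin expr2 ler_piMl// defect_le1.
- by move=> x; exact: sqr_defect_le_ent.
- exact: integral_excess_weighted.
- apply: (le_trans (integral_sqr_defect_weighted L0)); rewrite lee_fin.
  by have := integral_ent_ge0; lra.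
- move=> x z /=.
  have := cb x z; have := sqr_ge0 (p x * c (x, z) - phi x).
  have : (0 <= q z / t)%R by rewrite mulr_ge0.
  have := p0 x.
  have -> : (p x * q z / t * (2 * c (x, z) * phi x) =
    q z / t * (2 * (p x * c (x, z)) * phi x))%R by ring.
  have -> : (2 * k * p x ^+ 2 / t * (q z * b z) = q z / t * (2 * k * p x ^+ 2 * b z))%R by ring.
  move=> px qt sq cxz; rewrite -mulrDr ler_wpM2l//.
  have : (p x ^+ 2 * c (x, z) ^+ 2 <= p x ^+ 2 * (2 * k * (b x + b z)))%R.
    by rewrite ler_wpM2l// sqr_ge0.
  rewrite sqrrB exprMn in sq.
  lra.
Qed.

(** The mirror image, after exchanging the integrals: with
    [rho = excess f / f], it uses [2 (rho * c) phi <= (rho * c) ^ 2 + phi ^ 2]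
    against the measure [f mu], and [f rho ^ 2 = chi f]. *)
Lemma maxcoup_weak_snd (phi : S -> R) (L : R) : (0 <= L)%R ->
  measurable_fun setT phi -> (forall x, (0 <= phi x)%R) ->
  maxcoup mu f (fun xz => (2 * c xz * phi xz.2)%:E) <=
    (28 * k * ((1 + L) * h + expR (- L)))%:E + \int[mu]_x (f x * phi x ^+ 2)%:E.
Proof.
move=> L0 mphi phi0.
rewrite (diag0 (G := fun xz => 2 * c xz * phi xz.2)%R); last first.
  by move=> x; rewrite cxx mulr0 mul0r.
pose J xz := (p xz.1 * q xz.2 / t * (2 * c xz * phi xz.2))%R.
have mJ : measurable_fun setT J.
  apply: measurable_funM.
    by do 2 apply: measurable_funM => //; [exact: m1|exact: m2].
  apply: measurable_funM; last exact: m2.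
  exact: measurable_funM.
have J0 u : (0 <= J u)%R by rewrite !mulr_ge0.
have -> : \int[mu]_x \int[mu]_z (J (x, z))%:E = \int[mu]_z \int[mu]_x (J (x, z))%:E.
  apply: (fubini_tonelli (m1 := mu) (m2 := mu) (EFin \o J)).
    exact/measurable_EFinP.
  by move=> u; rewrite lee_fin.
apply: (@weak_cost_bound (fun zx => J (zx.2, zx.1)) g p (fun x => f x * phi x ^+ 2)%R) => //.
- by apply: (measurableT_comp mJ); exact: measurable_fun_pair.
- by apply: measurable_funM => //; exact: measurable_funX.
- by move=> x; rewrite mulr_ge0// sqr_ge0.
- exact: integral_defect.
- rewrite -(integral_excess mf f0 f1); apply: ge0_le_integral => //.
  + by move=> x _; rewrite lee_fin.
  + exact/measurable_EFinP.
  + exact/measurable_EFinP.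
  + by move=> x _; rewrite lee_fin; exact: chi_le_excess.
- by move=> x; exact: chi_le_ent.
- apply: (le_trans (integral_defect_weighted L0)); rewrite lee_fin.
  by have := integral_ent_ge0; have := t0; lra.
- exact: integral_chi_weighted.
- move=> z x; rewrite /J /=.
  have := cb x z; have := sqr_ge0 (q z / f z * c (x, z) - phi z).
  have pt : (0 <= p x / t)%R by rewrite mulr_ge0.
  have qE : q z = (f z * (q z / f z))%R.
    have [fz|fz] := eqVneq (f z) 0%R; last by rewrite mulrC divfK.
    by rewrite /q fz excess0 ?mul0r.
  have gE : g z = (f z * (q z / f z) ^+ 2)%R.
    rewrite /g /chi /q; have [->|fz] := eqVneq (f z) 0%R.
      by rewrite invr0 !mulr0 mul0r.
    by field.
  have := f0 z; rewrite gE [X in (p x * X / t)%R]qE; move: (q z / f z)%R => rho.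
  have -> : (p x * (f z * rho) / t * (2 * c (x, z) * phi z) =
    p x / t * (f z * (2 * (rho * c (x, z)) * phi z)))%R by ring.
  have -> : (2 * k * (f z * rho ^+ 2) / t * (p x * b x) =
    p x / t * (f z * (2 * k * rho ^+ 2 * b x)))%R by ring.
  have -> : (2 * k * (f z * rho ^+ 2) * b z + f z * phi z ^+ 2 =
    f z * (2 * k * rho ^+ 2 * b z + phi z ^+ 2))%R by ring.
  move=> fz sq cxz; rewrite -!mulrDr ler_wpM2l// ler_wpM2l//.
  have : (rho ^+ 2 * c (x, z) ^+ 2 <= rho ^+ 2 * (2 * k * (b x + b z)))%R.
    by rewrite ler_wpM2l// sqr_ge0.
  rewrite sqrrB exprMn in sq.
  lra.
Qed.

Lemma maxcoup_sqr (r : R) : (0 < r)%R ->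
  maxcoup mu f (fun xz => (c xz ^+ 2)%:E) <=
    (k * ((20 / r + 18) * h + 8 * r))%:E.
Proof.
move=> r0.
rewrite (diag0 (G := fun xz => c xz ^+ 2)%R); last first.
  by move=> x; rewrite cxx expr2 mul0r.
have k2 : (0 <= 2 * k)%R by rewrite mulr_ge0.
have := @le_integral_two_terms (fun xz => p xz.1 * q xz.2 / t * c xz ^+ 2)%R
  (fun x => 2 * k * (p x * b x))%R (fun x => 2 * k * p x)%R q b t (2 * k * t).
have mpb : measurable_fun setT (fun x => p x * b x)%R by exact: measurable_funM.
move=> two; apply: (le_trans (two _ _ _ _ _ _ _ _ _ _ _ _ _)) => //.
- apply: measurable_funM.
    by do 2 apply: measurable_funM => //; [exact: m1|exact: m2].
  exact: measurable_funX.
- exact: measurable_funM.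
- exact: measurable_funM.
- by move=> u; rewrite !mulr_ge0// sqr_ge0.
- by move=> x; rewrite !mulr_ge0.
- by move=> x; rewrite mulr_ge0.
- exact: integral_excess.
- under eq_integral do rewrite EFinM.
  rewrite ge0_integralZl//; first by rewrite integral_defect.
  + exact/measurable_EFinP.
  + by move=> x _; rewrite lee_fin.
- move=> x z /=.
  have -> : (q z / t * (2 * k * (p x * b x)) + 2 * k * p x / t * (q z * b z) =
     p x * q z / t * (2 * k * (b x + b z)))%R by ring.
  by rewrite ler_wpM2l// !mulr_ge0.
under eq_integral do rewrite EFinM.
rewrite ge0_integralZl//; last 2 first.
- exact/measurable_EFinP.
- by move=> x _; rewrite lee_fin mulr_ge0.
have vt0 : (0 <= 2 * k * t / t)%R by rewrite !mulr_ge0.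
have vt1 : (2 * k * t / t <= 2 * k)%R.
  have [->|tn0] := eqVneq t 0%R; first by rewrite mulr0 mul0r.
  by rewrite mulfK.
apply: (le_trans (leeD (lee_wpmul2l _ (integral_defect_am_gm r0))
  (lee_wpmul2l _ (integral_excess_am_gm r0)))).
- by rewrite lee_fin.
- by rewrite lee_fin.
rewrite -!EFinM -EFinD lee_fin.
have h0 := integral_ent_ge0.
have X0 : (0 <= (8 / r + 9) * h + 2 * r)%R.
  by rewrite addr_ge0 ?mulr_ge0 ?addr_ge0 ?divr_ge0// ltW.
have := ler_wpM2r X0 vt1; lra.
Qed.

End Cost.

End IntegralBounds.

(** * The subgaussian case on the line *)

Section OneCoordinate.
Context {R : realType} (K : R) (mu : probability (measurableTypeR R) R).
Hypotheses (K0 : (0 < K)%R) (psi : psi2_norm_le mu K).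
Variable f : measurableTypeR R -> R.
Hypotheses (mf : measurable_fun setT f) (f0 : forall x, (0 <= f x)%R)
  (f1 : \int[mu]_x (f x)%:E = 1).

Let c (xz : measurableTypeR R * measurableTypeR R) : R := `|xz.1 - xz.2|%R.
Let b (x : measurableTypeR R) : R := (x ^+ 2 / K ^+ 2)%R.
Let k := (K ^+ 2)%R.

Let k0 : (0 < k)%R. Proof. by rewrite exprn_gt0. Qed.

Let mc : measurable_fun setT c.
Proof.
apply: (measurableT_comp (@normr_measurable R setT)).
by apply: measurable_funB; [exact: measurable_fst|exact: measurable_snd].
Qed.

Let mb : measurable_fun setT b.
Proof. by apply: measurable_funM => //; exact: exprn_measurable. Qed.

Let b0 x : (0 <= b x)%R. Proof. by rewrite divr_ge0// sqr_ge0. Qed.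

Let cb x z : (c (x, z) ^+ 2 <= 2 * k * (b x + b z))%R.
Proof.
rewrite /c /= real_normK ?num_real// /b -/k -mulrDl.
have -> : (2 * k * ((x ^+ 2 + z ^+ 2) / k) = 2 * (x ^+ 2 + z ^+ 2))%R.
  by field; rewrite gt_eqF.
by have := sqr_ge0 (x + z); rewrite sqrrD sqrrB; lra.
Qed.

Let cxx x : c (x, x) = 0%R. Proof. by rewrite /c subrr normr0. Qed.

Let me : measurable_fun setT (fun x => (ent (f x))%:E).
Proof. by apply/measurable_EFinP; exact: measurable_ent. Qed.

Local Notation Ent := (\int[mu]_x (ent (f x))%:E).

Let Ent0 : 0 <= Ent.
Proof. by apply: integral_ge0 => x _; rewrite lee_fin ent_ge0. Qed.

(* If the entropy is infinite, so is the right-hand side. *)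
Let Ent_cases (a d : R) (X I : \bar R) : (0 < a)%R -> 0 <= I ->
  (forall h : R, Ent = h%:E -> X <= (a * h + d)%:E + I) ->
  X <= a%:E * Ent + d%:E + I.
Proof.
move=> a0 I0 XI; move: Ent0 XI; case: Ent => [h| |]// _ XI.
  by rewrite -EFinM -EFinD; exact: XI.
rewrite gt0_muley ?lte_fin//.
by move: I0; case: I XI => [i| |]//= _ _; rewrite leey.
Qed.

Lemma weak_cost_fst (phi : measurableTypeR R -> R) (L : R) : (0 <= L)%R ->
  measurable_fun setT phi -> (forall x, (0 <= phi x)%R) ->
  maxcoup mu f (fun xz => (2 * `|xz.1 - xz.2| * phi xz.1)%:E) <=
    (28 * K ^+ 2 * (1 + L))%:E * Ent + (28 * K ^+ 2 * expR (- L))%:E +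
    \int[mu]_x (phi x ^+ 2)%:E.
Proof.
move=> L0 mphi phi0; apply: Ent_cases.
- by rewrite !mulr_gt0//; lra.
- by apply: integral_ge0 => x _; rewrite lee_fin sqr_ge0.
move=> h hE.
have := @maxcoup_weak_fst _ _ _ mu f b h mf f0 f1 mb b0 psi hE c k mc
  (fun=> normr_ge0 _) cxx (ltW k0) cb phi L L0 mphi phi0.
by move/le_trans; apply; rewrite leeD2r// lee_fin /k; lra.
Qed.

Lemma weak_cost_snd (phi : measurableTypeR R -> R) (L : R) : (0 <= L)%R ->
  measurable_fun setT phi -> (forall x, (0 <= phi x)%R) ->
  maxcoup mu f (fun xz => (2 * `|xz.1 - xz.2| * phi xz.2)%:E) <=
    (28 * K ^+ 2 * (1 + L))%:E * Ent + (28 * K ^+ 2 * expR (- L))%:E +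
    \int[mu]_x (f x * phi x ^+ 2)%:E.
Proof.
move=> L0 mphi phi0; apply: Ent_cases.
- by rewrite !mulr_gt0//; lra.
- by apply: integral_ge0 => x _; rewrite lee_fin mulr_ge0// sqr_ge0.
move=> h hE.
have := @maxcoup_weak_snd _ _ _ mu f b h mf f0 f1 mb b0 psi hE c k mc
  (fun=> normr_ge0 _) cxx (ltW k0) cb phi L L0 mphi phi0.
by move/le_trans; apply; rewrite leeD2r// lee_fin /k; lra.
Qed.

Lemma sqr_cost (r : R) : (0 < r)%R ->
  maxcoup mu f (fun xz => (`|xz.1 - xz.2| ^+ 2)%:E) <=
    (K ^+ 2 * (20 / r + 18))%:E * Ent + (K ^+ 2 * (8 * r))%:E.
Proof.
move=> r0; rewrite -[leRHS]adde0; apply: Ent_cases => //.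
- by rewrite mulr_gt0// addr_gt0// divr_gt0.
move=> h hE; rewrite adde0.
have := @maxcoup_sqr _ _ _ mu f b h mf f0 f1 mb b0 psi hE c k mc
  (fun=> normr_ge0 _) cxx (ltW k0) cb r r0.
by move/le_trans; apply; rewrite lee_fin /k; lra.
Qed.

End OneCoordinate.

(** * Product measures on tuples *)

Lemma exists_pushforward d d' (T : measurableType d) (T' : measurableType d')
    (R : realType) (P : probability T R) (X : T -> T') :
  measurable_fun setT X ->
  exists Q : probability T' R, (forall A, Q A = P (X @^-1` A)) /\
  forall g : T' -> \bar R, measurable_fun setT g -> (forall x, 0 <= g x) ->
    \int[Q]_x g x = \int[P]_x g (X x).
Proof.
move=> mX; pose X' : {mfun T >-> T'} := mfun_Sub (mem_set mX).
exists (distribution P X'); split => // g mg g0.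
by rewrite ge0_integral_distribution.
Qed.

Section Tuples.
Context {R : realType}.

Lemma measurable_cons_pair n : measurable_fun setT
  (fun u : Rn R n * measurableTypeR R => [tuple of u.2 :: u.1] : Rn R n.+1).
Proof. exact: measurable_cons. Qed.

Lemma tnth_behead_lift n (x : Rn R n.+1) (i : 'I_n) :
  tnth ([tuple of behead x] : Rn R n) i = tnth x (lift ord0 i).
Proof.
case/tupleP: x => y x; rewrite tnthS; congr (tnth _ _).
exact: val_inj.
Qed.

Lemma measurable_rectangle n (A : 'I_n -> set (measurableTypeR R)) :
  (forall i, measurable (A i)) ->
  measurable [set x : Rn R n | forall i, A i (tnth x i)].
Proof.
move=> mA.
rewrite (_ : [set x | _] = \bigcap_i ((fun x : Rn R n => tnth x i) @^-1` A i)).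
  apply: fin_bigcap_measurable => // i _.
  rewrite -[X in measurable X]setTI; exact: measurable_tnth.
by apply/seteqP; split => x /= h i; [move=> _|]; apply: h.
Qed.

Lemma rectangles_generate n :
  @measurable _ (Rn R n) =
  <<s [set B : set (Rn R n) | exists2 A : 'I_n -> set (measurableTypeR R),
    (forall i, measurable (A i)) & B = [set x | forall i, A i (tnth x i)]] >>.
Proof.
apply/seteqP; split.
  apply: smallest_sub; first exact: smallest_sigma_algebra.
  move=> B; rewrite -bigcup_seq => -[i _] [C mC <-]; apply: sub_sigma_algebra.
  exists (fun j => if j == i then C else setT).
    by move=> j; case: ifP.
  rewrite setTI; apply/seteqP; split => x /=.
    by move=> Cx j; case: eqP => // ->.
  by move=> /(_ i); rewrite eqxx.
apply: smallest_sub; first exact: sigma_algebra_measurable.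
by move=> _ [A mA ->]; exact: measurable_rectangle.
Qed.

Lemma measure_tuple_unique n (P P' : probability (Rn R n) R) :
  (forall A : 'I_n -> set (measurableTypeR R), (forall i, measurable (A i)) ->
    P [set x | forall i, A i (tnth x i)] = P' [set x | forall i, A i (tnth x i)]) ->
  forall B, measurable B -> P B = P' B.
Proof.
move=> PP' B mB.
apply: (measure_unique _ (fun=> setT) (rectangles_generate n)) => //.
- move=> _ _ [A mA ->] [C mC ->]; exists (fun i => A i `&` C i).
    by move=> i; exact: measurableI.
  by apply/seteqP; split => x /=; [move=> [h1 h2] i; split|move=> h; split=> i; have [] := h i].
- by move=> _; exists (fun=> setT) => //; apply/seteqP; split.
- by rewrite bigcup_const//; exists 0%N.
- by move=> _ [A mA ->]; exact: PP'.
- by move=> _ /=; rewrite [X in X < _]probability_setT ltry.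
Qed.

(** The law of the tail of [P] is again a product measure, and by uniqueness on
    rectangles [P] is the product of that law with [mu ord0]. *)
Lemma product_measure_cons n (mu : 'I_n.+1 -> probability (measurableTypeR R) R)
    (P : probability (Rn R n.+1) R) :
  is_product_measure mu P ->
  exists P' : probability (Rn R n) R,
    is_product_measure (fun i => mu (lift ord0 i)) P' /\
    forall g : Rn R n.+1 -> \bar R, measurable_fun setT g -> (forall x, 0 <= g x) ->
    \int[P]_x g x = \int[P']_x \int[mu ord0]_y g [tuple of y :: x].
Proof.
move=> hP.
have [P' [P'E _]] := exists_pushforward P (@measurable_behead _ (measurableTypeR R) n).
have prodP' : is_product_measure (fun i => mu (lift ord0 i)) P'.
  move=> A mA; rewrite P'E.
  pose A' i := if unlift ord0 i is Some j then A j else setT.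
  rewrite (_ : _ @^-1` _ = [set x | forall i, A' i (tnth x i)]).
    rewrite hP; last by move=> i; rewrite /A'; case: unliftP.
    rewrite big_ord_recl {1}/A' unlift_none probability_setT mul1e.
    by apply: eq_bigr => i _; rewrite /A' liftK.
  apply/seteqP; split => x /= h i.
    by rewrite /A'; case: unliftP => [j ->|//]; rewrite -tnth_behead_lift.
  by rewrite tnth_behead_lift; have := h (lift ord0 i); rewrite /A' liftK.
exists P'; split => //.
pose PP : probability _ R := P' \x mu ord0.
have [P2 [P2E P2i]] := exists_pushforward PP (@measurable_cons_pair n).
move=> g mg g0.
rewrite (eq_measure_integral P2); last first.
  move=> B mB _; apply: measure_tuple_unique mB => A mA.
  rewrite hP// P2E (_ : _ @^-1` _ =
    [set x | forall i, A (lift ord0 i) (tnth x i)] `*` A ord0).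
    rewrite [RHS]product_measure1E//.
      by rewrite big_ord_recl muleC; congr (_ * _); apply/esym; exact: (prodP' (fun i => A (lift ord0 i))).
    exact: (measurable_rectangle (A := fun i => A (lift ord0 i))).
  apply/seteqP; split => [[x y] /= h|[x y] /= [h1 h2] i].
    by split => [i|]; [have := h (lift ord0 i); rewrite tnthS|have := h ord0].
  by case: (unliftP ord0 i) => [j ->|->//]; rewrite tnthS.
rewrite P2i// (fubini_tonelli1 (fun u : Rn R n * measurableTypeR R => g [tuple of u.2 :: u.1]))//.
exact: (measurableT_comp mg (@measurable_cons_pair n)).
Qed.

End Tuples.

(** * Marginal and conditional densities *)

(** Integrated against a probability density in [u] the middle term vanishes:
    this is the chain rule for entropy. *)
Lemma entM {R : realType} (a u : R) : (0 < a)%R -> (0 <= u)%R ->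
  (ent (a * u) = a * ent u + (u - 1) * (a * ln a) + ent a)%R.
Proof.
move=> a0; rewrite le_eqVlt => /predU1P[<-|u0]; rewrite /ent.
  by rewrite mulr0 !mul0r; ring.
by rewrite lnM ?posrE//; ring.
Qed.

Section ConditionalDensity.
Context d d' (Z : measurableType d) (S : measurableType d') (R : realType).
Variables (P : probability Z R) (mu : probability S R) (F : Z * S -> R).
Hypotheses (mF : measurable_fun setT F) (F0 : forall u, (0 <= F u)%R)
  (F1 : \int[P]_z \int[mu]_y (F (z, y))%:E = 1).

Definition marginal_density (z : Z) : R := fine (\int[mu]_y (F (z, y))%:E).

(** The value 1 keeps [cond_density] a probability density for every [z]. It is
    used where [F (z, .)] vanishes almost everywhere, or where its integral is
    infinite, which happens for a null set of [z] only. *)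
Definition cond_density (u : Z * S) : R :=
  if (0 < marginal_density u.1)%R then (F u / marginal_density u.1)%R else 1%R.

Local Notation F' := marginal_density.
Local Notation f := cond_density.

Let mFz z : measurable_fun setT (fun y => F (z, y)).
Proof. by apply: (measurableT_comp mF); exact: pair1_measurable. Qed.

Let mI : measurable_fun setT (fun z => \int[mu]_y (F (z, y))%:E).
Proof.
apply: (@measurable_fun_fubini_tonelli_F _ _ _ _ _ mu (fun u => (F u)%:E)).
  exact/measurable_EFinP.
by move=> u; rewrite lee_fin.
Qed.

Let I0 z : 0 <= \int[mu]_y (F (z, y))%:E.
Proof. by apply: integral_ge0 => y _; rewrite lee_fin. Qed.

Lemma measurable_marginal_density : measurable_fun setT F'.
Proof. exact: (measurableT_comp (@fine_measurable R setT measurableT)). Qed.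

Lemma marginal_density_ge0 z : (0 <= F' z)%R.
Proof. by rewrite /marginal_density fine_ge0. Qed.

Lemma measurable_cond_density : measurable_fun setT f.
Proof.
have m1 : measurable_fun setT (fun u : Z * S => F' u.1).
  by apply: (measurableT_comp measurable_marginal_density).
apply: measurable_fun_ifT => //.
  exact: measurable_fun_ltr.
apply: measurable_funM => //; exact: (measurableT_comp (@measurable_invr R)).
Qed.

Lemma cond_density_ge0 u : (0 <= f u)%R.
Proof. by rewrite /cond_density; case: ifP => // h; rewrite divr_ge0// ltW. Qed.

Let marginalE z : (0 < F' z)%R -> \int[mu]_y (F (z, y))%:E = (F' z)%:E.
Proof. by rewrite /marginal_density; case: (\int[mu]_y _) => //=; rewrite ltxx. Qed.

Lemma integral_cond_density z : \int[mu]_y (f (z, y))%:E = 1.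
Proof.
have [h|h] := boolP (0 < F' z)%R; last first.
  under eq_integral do rewrite /cond_density /= (negbTE h).
  by rewrite integral_cst_probability.
under eq_integral do rewrite /cond_density /= h mulrC EFinM.
rewrite ge0_integralZl//.
- by rewrite marginalE// -EFinM mulVf ?gt_eqF.
- exact/measurable_EFinP.
- by move=> y _; rewrite lee_fin.
- by rewrite lee_fin invr_ge0 marginal_density_ge0.
Qed.

Lemma ae_marginal_density : {ae P, forall z, \int[mu]_y (F (z, y))%:E = (F' z)%:E}.
Proof.
have : P.-integrable setT (fun z => \int[mu]_y (F (z, y))%:E).
  apply/integrableP; split => //.
  by under eq_integral do rewrite gee0_abs//; rewrite F1 ltry.
move=> /(integrable_ae measurableT); apply: filterS => z /(_ I) h.
by rewrite /marginal_density fineK.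
Qed.

Lemma integral_marginal_density : \int[P]_z (F' z)%:E = 1.
Proof.
rewrite -F1; apply: ge0_ae_eq_integral => //.
- by apply/measurable_EFinP; exact: measurable_marginal_density.
- by move=> z _; rewrite lee_fin marginal_density_ge0.
- by move: ae_marginal_density; apply: filterS => z ->.
Qed.

Let null z : \int[mu]_y (F (z, y))%:E = (F' z)%:E -> ~~ (0 < F' z)%R ->
  F' z = 0%R /\ ae_eq mu setT (fun y => (F (z, y))%:E) (cst 0).
Proof.
move=> zE; rewrite -leNgt => h.
have z0 : F' z = 0%R by apply/eqP; rewrite eq_le h marginal_density_ge0.
split => //; apply/ae_eq_integral_abs => //; first exact/measurable_EFinP.
by under eq_integral do rewrite gee0_abs ?lee_fin//; rewrite zE z0.
Qed.

(** The law with density [F] is composed of its marginal, of density [F'], and of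
    the conditional laws of density [f (z, .)]. *)
Lemma integral_cond_densityM (G : Z * S -> \bar R) :
  measurable_fun setT G -> (forall u, 0 <= G u) ->
  \int[P]_z ((F' z)%:E * \int[mu]_y ((f (z, y))%:E * G (z, y))) =
  \int[P]_z \int[mu]_y ((F (z, y))%:E * G (z, y)).
Proof.
move=> mG G0.
have mfG : measurable_fun setT (fun u => (f u)%:E * G u).
  by apply: emeasurable_funM => //; apply/measurable_EFinP; exact: measurable_cond_density.
have fG0 u : 0 <= (f u)%:E * G u by rewrite mule_ge0// lee_fin cond_density_ge0.
have mFG : measurable_fun setT (fun u => (F u)%:E * G u).
  by apply: emeasurable_funM => //; exact/measurable_EFinP.
have FG0 u : 0 <= (F u)%:E * G u by rewrite mule_ge0// lee_fin.
have mi := measurable_fun_fubini_tonelli_F (m2 := mu) _ mfG fG0.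
have mi' := measurable_fun_fubini_tonelli_F (m2 := mu) _ mFG FG0.
apply: ge0_ae_eq_integral => //.
- apply: emeasurable_funM => //; apply/measurable_EFinP.
  exact: measurable_marginal_density.
- move=> z _; rewrite mule_ge0 ?lee_fin ?marginal_density_ge0//.
  exact: integral_ge0.
- by move=> z _; exact: integral_ge0.
move: ae_marginal_density; apply: filterS => z zE _.
have [h|h'] := boolP (0 < F' z)%R.
  rewrite -ge0_integralZl//.
  - apply: eq_integral => y _; rewrite muleA -EFinM /cond_density /= h mulrC.
    by rewrite divfK// gt_eqF.
  - by apply: (measurableT_comp mfG); exact: pair1_measurable.
  - by rewrite lee_fin marginal_density_ge0.
have [z0 ae0] := null zE h'.
rewrite z0 mul0e; symmetry.
rewrite (ge0_ae_eq_integral (g := cst 0)) ?integral0//.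
- by apply: (measurableT_comp mFG); exact: pair1_measurable.
- by apply: filterS ae0 => y /(_ I) -> _; rewrite mul0e.
Qed.

(** Where the marginal density is positive, integrate [entM] over the second
    coordinate; where it vanishes, both sides reduce to [ent 0]. *)
Lemma entropy_chain :
  \int[P]_z (ent (F' z))%:E +
    \int[P]_z ((F' z)%:E * \int[mu]_y (ent (f (z, y)))%:E) <=
  \int[P]_z \int[mu]_y (ent (F (z, y)))%:E.
Proof.
have mef : measurable_fun setT (fun u => (ent (f u))%:E).
  by apply/measurable_EFinP/measurable_ent; exact: measurable_cond_density.
have ef0 u : 0 <= (ent (f u))%:E by rewrite lee_fin ent_ge0// cond_density_ge0.
have meF : measurable_fun setT (fun u => (ent (F u))%:E).
  by apply/measurable_EFinP/measurable_ent.
have eF0 u : 0 <= (ent (F u))%:E by rewrite lee_fin ent_ge0.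
have mi := measurable_fun_fubini_tonelli_F (m2 := mu) _ mef ef0.
have mi' := measurable_fun_fubini_tonelli_F (m2 := mu) _ meF eF0.
have mF' := measurable_marginal_density.
have F'0 := marginal_density_ge0.
have i0 z : 0 <= \int[mu]_y (ent (f (z, y)))%:E by exact: integral_ge0.
rewrite -ge0_integralD//; last 4 first.
- by move=> z _; rewrite lee_fin ent_ge0.
- exact/measurable_EFinP/measurable_ent.
- by move=> z _; rewrite mule_ge0// lee_fin.
- by apply: emeasurable_funM => //; exact/measurable_EFinP.
apply: ae_ge0_le_integral => //.
- by move=> z _; rewrite adde_ge0 ?mule_ge0 ?lee_fin ?ent_ge0.
- apply: emeasurable_funD; first exact/measurable_EFinP/measurable_ent.
  by apply: emeasurable_funM => //; exact/measurable_EFinP.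
- by move=> z _; exact: integral_ge0.
move: ae_marginal_density; apply: filterS => z zE _.
have [h|h] := boolP (0 < F' z)%R; last first.
  have [z0 ae0] := null zE h.
  rewrite z0 mul0e adde0.
  rewrite [leRHS](ge0_ae_eq_integral (g := cst (ent (0 : R))%:E)) ?integral_cst_probability//.
  - by apply: (measurableT_comp meF); exact: pair1_measurable.
  - by move=> y _; rewrite lee_fin ent_ge0.
  - by apply: filterS ae0 => y /(_ I) [->].
set a := F' z in h *.
(* [a ln a] has no sign: its positive and negative parts are put on opposite
   sides of the identity, so that all integrands are nonnegative. *)
pose c1 := Num.max (a * ln a)%R 0%R; pose c2 := Num.max (- (a * ln a))%R 0%R.
have c10 : (0 <= c1)%R by rewrite le_max lexx orbT.
have c20 : (0 <= c2)%R by rewrite le_max lexx orbT.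
have cE : (a * ln a = c1 - c2)%R.
  by rewrite /c1 /c2; case: (leP 0 (a * ln a))%R; case: (leP 0 (- (a * ln a)))%R; lra.
have mfz : measurable_fun setT (fun y => f (z, y)).
  by apply: (measurableT_comp measurable_cond_density); exact: pair1_measurable.
have fz0 y : (0 <= f (z, y))%R by exact: cond_density_ge0.
have FE y : F (z, y) = (a * f (z, y))%R.
  by rewrite /cond_density /= -/a h mulrC divfK// gt_eqF.
have key : \int[mu]_y ((ent (F (z, y)))%:E + (c2%:E * (f (z, y))%:E + c1%:E)) =
  \int[mu]_y ((a%:E * (ent (f (z, y)))%:E) + ((c1%:E * (f (z, y))%:E) + (ent a + c2)%:E)).
  apply: eq_integral => y _; rewrite FE entM// -!EFinM -!EFinD cE; congr EFin; ring.
have mlin (c : R) : measurable_fun setT (fun y => c%:E * (f (z, y))%:E).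
  by apply/measurable_EFinP; exact: measurable_funM.
have ilin (c : R) : (0 <= c)%R -> \int[mu]_y (c%:E * (f (z, y))%:E) = c%:E.
  move=> c0; rewrite ge0_integralZl// ?integral_cond_density ?mule1//.
  - exact/measurable_EFinP.
  - by move=> y _; rewrite lee_fin.
have ea0 : (0 <= ent a)%R by rewrite ent_ge0// ltW.
have mez : measurable_fun setT (fun y => (ent (f (z, y)))%:E).
  by apply: (measurableT_comp mef); exact: pair1_measurable.
have meFz : measurable_fun setT (fun y => (ent (F (z, y)))%:E).
  by apply: (measurableT_comp meF); exact: pair1_measurable.
have lin0 (c : R) y : (0 <= c)%R -> 0 <= c%:E * (f (z, y))%:E.
  by move=> c0; rewrite mule_ge0// lee_fin.
move: key; rewrite !ge0_integralD//; last first.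
all: try by [move=> y _; rewrite ?adde_ge0 ?lin0 ?lee_fin ?addr_ge0// |
  apply: emeasurable_funD].
all: try by (move=> y _; rewrite -EFinM lee_fin mulr_ge0 ?ent_ge0// ltW).
all: try by (apply: emeasurable_funM => //).
- by move=> y _; rewrite adde_ge0 ?lin0// lee_fin addr_ge0.
- by move=> y _; rewrite lee_fin addr_ge0.
rewrite !ilin// !integral_cst_probability.
rewrite ge0_integralZl//; last by rewrite lee_fin ltW.
set E := \int[mu]_y (ent (F (z, y)))%:E; set h' := a%:E * _ => key.
rewrite -(@leeD2rE _ (c2 + c1)%:E)// [in leRHS]EFinD key.
by rewrite [_ + h']addeC -addeA leeD2l// -!EFinD lee_fin; lra.
Qed.

End ConditionalDensity.

(** * Adding a coordinate to the coupling *)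

(** The induction hypothesis. The laws of [X] and [Y] are [P] and [F P]. The
    three costs are in a form that is affine in the entropy, and the weak ones
    are in dual form. For [Y] the test functions are bounded, so that their
    averages over a coordinate are finite. *)
Record transport_coupling (R : realType) (K : R) n (P : probability (Rn R n) R)
    (F : Rn R n -> R) d (T : measurableType d) (Pr : probability T R)
    (X Y : T -> Rn R n) : Prop := TransportCoupling {
  tc_mX : measurable_fun setT X ;
  tc_mY : measurable_fun setT Y ;
  tc_lawX : forall g : Rn R n -> \bar R, measurable_fun setT g ->
    (forall x, 0 <= g x) -> \int[Pr]_w g (X w) = \int[P]_x g x ;
  tc_lawY : forall g : Rn R n -> \bar R, measurable_fun setT g ->
    (forall x, 0 <= g x) -> \int[Pr]_w g (Y w) = \int[P]_x ((F x)%:E * g x) ;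
  tc_costX : forall (L : R) (phi : 'I_n -> Rn R n -> R), (0 <= L)%R ->
    (forall i, measurable_fun setT (phi i)) -> (forall i x, (0 <= phi i x)%R) ->
    \sum_(i < n) \int[Pr]_w (2 * `|tnth (X w) i - tnth (Y w) i| * phi i (X w))%:E <=
    (28 * K ^+ 2 * (1 + L))%:E * \int[P]_x (ent (F x))%:E +
    (28 * K ^+ 2 * expR (- L) * n%:R)%:E + \sum_(i < n) \int[Pr]_w (phi i (X w) ^+ 2)%:E ;
  tc_costY : forall (L M : R) (phi : 'I_n -> Rn R n -> R), (0 <= L)%R ->
    (forall i, measurable_fun setT (phi i)) -> (forall i x, (0 <= phi i x <= M)%R) ->
    \sum_(i < n) \int[Pr]_w (2 * `|tnth (X w) i - tnth (Y w) i| * phi i (Y w))%:E <=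
    (28 * K ^+ 2 * (1 + L))%:E * \int[P]_x (ent (F x))%:E +
    (28 * K ^+ 2 * expR (- L) * n%:R)%:E + \sum_(i < n) \int[Pr]_w (phi i (Y w) ^+ 2)%:E ;
  tc_costE : forall r : R, (0 < r)%R ->
    \sum_(i < n) \int[Pr]_w (`|tnth (X w) i - tnth (Y w) i| ^+ 2)%:E <=
    (K ^+ 2 * (20 / r + 18))%:E * \int[P]_x (ent (F x))%:E +
    (K ^+ 2 * (8 * r) * n%:R)%:E }.

Section WeightedMean.
Context d (S : measurableType d) (R : realType) (mu : probability S R).
Variables (f phi : S -> R) (M : R).
Hypotheses (mf : measurable_fun setT f) (f0 : forall x, (0 <= f x)%R)
  (f1 : \int[mu]_x (f x)%:E = 1)
  (mphi : measurable_fun setT phi) (phiM : forall x, (0 <= phi x <= M)%R).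

Definition weighted_mean : R := fine (\int[mu]_x (f x * phi x)%:E).
Local Notation m := weighted_mean.

Let phi0 x : (0 <= phi x)%R. Proof. by have /andP[] := phiM x. Qed.
Let mfp : measurable_fun setT (fun x => (f x * phi x)%:E).
Proof. by apply/measurable_EFinP; exact: measurable_funM. Qed.
Let mfE : measurable_fun setT (EFin \o f). Proof. exact/measurable_EFinP. Qed.

Let int_le : \int[mu]_x (f x * phi x)%:E <= M%:E.
Proof.
have M0 : (0 <= M)%R by have /andP[/le_trans h /h] := phiM point.
rewrite -[leRHS]mule1 -f1 -ge0_integralZl//; last by move=> x _; rewrite lee_fin.
apply: ge0_le_integral => //.
- by move=> x _; rewrite lee_fin mulr_ge0.
- exact: emeasurable_funM.
- by move=> x _; rewrite -EFinM lee_fin mulrC ler_wpM2r//; have /andP[] := phiM x.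
Qed.

Lemma integral_weighted_mean : \int[mu]_x (f x * phi x)%:E = m%:E.
Proof.
rewrite fineK// ge0_fin_numE; first by rewrite (le_lt_trans int_le)// ltry.
by apply: integral_ge0 => x _; rewrite lee_fin mulr_ge0.
Qed.

Lemma weighted_mean_itv : (0 <= m <= M)%R.
Proof.
rewrite -!lee_fin -integral_weighted_mean int_le andbT.
by apply: integral_ge0 => x _; rewrite lee_fin mulr_ge0.
Qed.

(** Jensen's inequality, from [2 m phi <= m ^ 2 + phi ^ 2] averaged. *)
Lemma sqr_weighted_mean_le : (m ^+ 2)%:E <= \int[mu]_x (f x * phi x ^+ 2)%:E.
Proof.
have /andP[m0 _] := weighted_mean_itv.
have ms : measurable_fun setT (fun x => (f x * phi x ^+ 2)%:E).
  by apply/measurable_EFinP; apply: measurable_funM => //; exact: measurable_funX.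
have s0 x : 0 <= (f x * phi x ^+ 2)%:E by rewrite lee_fin mulr_ge0// sqr_ge0.
have : \int[mu]_x ((2 * m)%:E * (f x * phi x)%:E) <=
       \int[mu]_x ((m ^+ 2)%:E * (f x)%:E + (f x * phi x ^+ 2)%:E).
  apply: ge0_le_integral => //.
  - by move=> x _; rewrite -EFinM lee_fin !mulr_ge0.
  - exact: emeasurable_funM.
  - by apply: emeasurable_funD => //; exact: emeasurable_funM.
  - move=> x _; rewrite -!EFinM -EFinD lee_fin.
    have := mulr_ge0 (f0 x) (sqr_ge0 (m - phi x)); rewrite sqrrB; lra.
rewrite ge0_integralD//; last 2 first.
- by move=> x _; rewrite mule_ge0 ?lee_fin// sqr_ge0.
- exact: emeasurable_funM.
rewrite !ge0_integralZl//; last 4 first.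
- by move=> x _; rewrite lee_fin mulr_ge0.
- by rewrite lee_fin mulr_ge0.
- by move=> x _; rewrite lee_fin.
- by rewrite lee_fin sqr_ge0.
rewrite integral_weighted_mean f1 mule1 -EFinM.
have -> : (2 * m * m = m ^+ 2 + m ^+ 2)%R by ring.
by rewrite EFinD leeD2lE.
Qed.

End WeightedMean.

(** [P] is the product of the tail law [P'] and of the head law [mu]; [F'] and [f]
    are the marginal density of the tail and the conditional density of the head.
    They are abstract here, known only through [condE] and [entE]. *)
Section Step.
Context {R : realType} (K : R) (n : nat).
Hypothesis K0 : (0 < K)%R.
Local Notation RR := (measurableTypeR R).
Variables (P : probability (Rn R n.+1) R) (P' : probability (Rn R n) R)
  (mu : probability RR R) (F : Rn R n.+1 -> R) (F' : Rn R n -> R)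
  (f : Rn R n * RR -> R).

Let cons2 (u : Rn R n * RR) : Rn R n.+1 := [tuple of u.2 :: u.1].
Let mcons : measurable_fun setT cons2. Proof. exact: measurable_cons_pair. Qed.

Hypotheses (psi : psi2_norm_le mu K)
  (mF : measurable_fun setT F) (F0 : forall x, (0 <= F x)%R)
  (F'0 : forall x, (0 <= F' x)%R)
  (mf : measurable_fun setT f) (f0 : forall u, (0 <= f u)%R)
  (f1 : forall z, \int[mu]_y (f (z, y))%:E = 1).
Hypothesis PE : forall g : Rn R n.+1 -> \bar R, measurable_fun setT g ->
  (forall x, 0 <= g x) -> \int[P]_x g x = \int[P']_x \int[mu]_y g [tuple of y :: x].
Hypothesis condE : forall G : Rn R n * RR -> \bar R, measurable_fun setT G ->
  (forall u, 0 <= G u) ->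
  \int[P']_z ((F' z)%:E * \int[mu]_y ((f (z, y))%:E * G (z, y))) =
  \int[P']_z \int[mu]_y ((F [tuple of y :: z])%:E * G (z, y)).
Hypothesis entE : \int[P']_z (ent (F' z))%:E +
    \int[P']_z ((F' z)%:E * \int[mu]_y (ent (f (z, y)))%:E) <=
  \int[P']_z \int[mu]_y (ent (F [tuple of y :: z]))%:E.

Let mfz z : measurable_fun setT (fun y => f (z, y)).
Proof. by apply: (measurableT_comp mf); exact: pair1_measurable. Qed.

Variables (d : measure_display) (T : measurableType d) (Pr : probability T R)
  (X' Y' : T -> Rn R n).
Hypothesis gc : transport_coupling K P' F' Pr X' Y'.

Let mX' := tc_mX gc.
Let mY' := tc_mY gc.
Let lawX' := tc_lawX gc.
Let lawY' := tc_lawY gc.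

Let fT (u : T * RR) : R := f (Y' u.1, u.2).
Let mfT : measurable_fun setT fT.
Proof.
apply: (measurableT_comp mf); apply: measurable_fun_pair => //.
exact: measurableT_comp.
Qed.
Let fT0 u : (0 <= fT u)%R. Proof. exact: f0. Qed.
Let fT1 w : \int[mu]_y (fT (w, y))%:E = 1.
Proof. by rewrite -(f1 (Y' w)); exact: eq_integral. Qed.

Variable (Pr' : probability (T * (RR * RR))%type R).
Hypothesis Pr'E : forall G : T * (RR * RR) -> \bar R,
  measurable_fun setT G -> (forall u, 0 <= G u) ->
  \int[Pr']_u G u =
  \int[Pr]_w maxcoup mu (fun x => fT (w, x)) (fun xz => G (w, xz)).

Let X (u : T * (RR * RR)) : Rn R n.+1 := [tuple of u.2.1 :: X' u.1].
Let Y (u : T * (RR * RR)) : Rn R n.+1 := [tuple of u.2.2 :: Y' u.1].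

Let mX : measurable_fun setT X.
Proof.
apply: measurable_cons; first exact: measurableT_comp.
exact: measurableT_comp.
Qed.
Let mY : measurable_fun setT Y.
Proof.
apply: measurable_cons; first exact: measurableT_comp.
exact: measurableT_comp.
Qed.

Let mx1 : measurable_fun setT (fun u : T * RR => cons2 (X' u.1, u.2)).
Proof.
apply: (measurableT_comp mcons); apply: measurable_fun_pair => //.
exact: measurableT_comp.
Qed.
Let my1 : measurable_fun setT (fun u : T * RR => cons2 (Y' u.1, u.2)).
Proof.
apply: (measurableT_comp mcons); apply: measurable_fun_pair => //.
exact: measurableT_comp.
Qed.

Let Pr'_fst (G : T * RR -> \bar R) : measurable_fun setT G -> (forall u, 0 <= G u) ->
  \int[Pr']_u G (u.1, u.2.1) = \int[Pr]_w \int[mu]_y G (w, y).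
Proof.
move=> mG G0; rewrite (Pr'E (G := fun u => G (u.1, u.2.1)))//.
  apply: eq_integral => w _ /=.
  rewrite (@maxcoup_fst _ _ _ mu (fun x => fT (w, x)) _ _ _ (fun y => G (w, y)))//.
  - by apply: (measurableT_comp mfT); exact: pair1_measurable.
  - by apply: (measurableT_comp mG); exact: pair1_measurable.
apply: (measurableT_comp mG); apply: measurable_fun_pair => //.
exact: measurableT_comp.
Qed.

Let Pr'_snd (G : T * RR -> \bar R) : measurable_fun setT G -> (forall u, 0 <= G u) ->
  \int[Pr']_u G (u.1, u.2.2) = \int[Pr]_w \int[mu]_y ((f (Y' w, y))%:E * G (w, y)).
Proof.
move=> mG G0; rewrite (Pr'E (G := fun u => G (u.1, u.2.2)))//.
  apply: eq_integral => w _ /=.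
  rewrite (@maxcoup_snd _ _ _ mu (fun x => fT (w, x)) _ _ _ (fun y => G (w, y)))//.
  - by apply: (measurableT_comp mfT); exact: pair1_measurable.
  - by apply: (measurableT_comp mG); exact: pair1_measurable.
apply: (measurableT_comp mG); apply: measurable_fun_pair => //.
exact: measurableT_comp.
Qed.

Let lawX (g : Rn R n.+1 -> \bar R) : measurable_fun setT g ->
  (forall x, 0 <= g x) -> \int[Pr']_u g (X u) = \int[P]_x g x.
Proof.
move=> mg g0.
rewrite (Pr'_fst (G := fun u => g (cons2 (X' u.1, u.2))))//; last exact: measurableT_comp.
rewrite PE//.
apply: (@lawX' (fun x => \int[mu]_y g (cons2 (x, y)))).
  apply: (measurable_fun_fubini_tonelli_F (m2 := mu) (g \o cons2)) => //=.
  exact: measurableT_comp.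
by move=> x; exact: integral_ge0.
Qed.

Let lawY (g : Rn R n.+1 -> \bar R) : measurable_fun setT g ->
  (forall x, 0 <= g x) -> \int[Pr']_u g (Y u) = \int[P]_x ((F x)%:E * g x).
Proof.
move=> mg g0.
have mg2 : measurable_fun setT (g \o cons2) by exact: measurableT_comp.
have mfg : measurable_fun setT (fun u => (f u)%:E * (g \o cons2) u).
  by apply: emeasurable_funM => //; exact/measurable_EFinP.
rewrite (Pr'_snd (G := fun u => g (cons2 (Y' u.1, u.2))))//; last exact: measurableT_comp.
rewrite PE//.
- rewrite -(condE mg2); last by move=> u; exact: g0.
  apply: (@lawY' (fun x => \int[mu]_y ((f (x, y))%:E * g (cons2 (x, y))))).
    apply: (measurable_fun_fubini_tonelli_F (m2 := mu) _ mfg) => //=.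
    by move=> u; rewrite mule_ge0// lee_fin.
  by move=> x; apply: integral_ge0 => y _; rewrite mule_ge0// lee_fin.
- by apply: emeasurable_funM => //; exact/measurable_EFinP.
- by move=> x; rewrite mule_ge0// lee_fin.
Qed.

(* The conditional entropy of the head of [Y] given its tail. *)
Variable h : Rn R n -> \bar R.
Hypothesis hE : forall z, h z = \int[mu]_y (ent (f (z, y)))%:E.

Let h0 z : 0 <= h z.
Proof. by rewrite hE; apply: integral_ge0 => y _; rewrite lee_fin ent_ge0. Qed.

Let mh : measurable_fun setT h.
Proof.
rewrite (_ : h = fun z => \int[mu]_y (ent (f (z, y)))%:E); last exact/funext.
apply: (measurable_fun_fubini_tonelli_F (m2 := mu) (fun u => (ent (f u))%:E)).
  exact/measurable_EFinP/measurable_ent.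
by move=> u; rewrite lee_fin ent_ge0.
Qed.

Let mhY : measurable_fun setT (fun w => h (Y' w)).
Proof. exact: measurableT_comp. Qed.

Let chain : \int[P']_z (ent (F' z))%:E + \int[Pr]_w h (Y' w) <= \int[P]_x (ent (F x))%:E.
Proof.
rewrite (tc_lawY gc)// PE//.
- by apply: le_trans entE; rewrite leeD2l//; under eq_integral do rewrite hE.
- exact/measurable_EFinP/measurable_ent.
- by move=> x; rewrite lee_fin ent_ge0.
Qed.

Let Ent'0 : 0 <= \int[P']_z (ent (F' z))%:E.
Proof. by apply: integral_ge0 => x _; rewrite lee_fin ent_ge0. Qed.

(* The cost of the head, integrated over the tails, and the costs of the tails
   add up to the required bound by the chain rule. *)
Let assemble (a b : R) (S0 S1 I0 I1 : \bar R) : (0 <= a)%R -> (0 <= b)%R ->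
  S0 <= a%:E * \int[Pr]_w h (Y' w) + b%:E + I0 ->
  S1 <= a%:E * \int[P']_z (ent (F' z))%:E + (b * n%:R)%:E + I1 ->
  S0 + S1 <= a%:E * \int[P]_x (ent (F x))%:E + (b * n.+1%:R)%:E + (I0 + I1).
Proof.
move=> a0 b0 H0 H1; apply: (le_trans (leeD H0 H1)).
rewrite addeACA leeD2r// addeACA -EFinD.
have -> : (b + b * n%:R = b * n.+1%:R)%R by rewrite -natr1; ring.
rewrite leeD2r// -ge0_muleDr//; last exact: integral_ge0.
by rewrite lee_wpmul2l// addeC.
Qed.

Let integral_affine (a b : R) (g : T -> \bar R) : (0 <= a)%R -> (0 <= b)%R ->
  measurable_fun setT g -> (forall w, 0 <= g w) ->
  \int[Pr]_w (a%:E * h (Y' w) + b%:E + g w) =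
  a%:E * \int[Pr]_w h (Y' w) + b%:E + \int[Pr]_w g w.
Proof.
move=> a0 b0 mg g0.
have mah : measurable_fun setT (fun w => a%:E * h (Y' w)) by exact: emeasurable_funM.
have ah0 w : 0 <= a%:E * h (Y' w) by rewrite mule_ge0.
rewrite ge0_integralD//.
- by rewrite ge0_integralD// ge0_integralZl// integral_cst_probability.
- by move=> w _; rewrite adde_ge0.
- by apply: emeasurable_funD.
Qed.

Let mbound (a b : R) (g : T -> \bar R) : measurable_fun setT g ->
  measurable_fun setT (fun w => a%:E * h (Y' w) + b%:E + g w).
Proof.
by move=> mg; do 2 apply: emeasurable_funD => //; exact: emeasurable_funM.
Qed.

Let k := (28 * K ^+ 2)%R.
Let k0 : (0 <= k)%R. Proof. by rewrite mulr_ge0// sqr_ge0. Qed.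

Let dist i (w : T) : R := `|tnth (X' w) i - tnth (Y' w) i|%R.

Let mdist i : measurable_fun setT (dist i).
Proof.
apply: (measurableT_comp (@normr_measurable R setT)).
by apply: measurable_funB; apply: (measurableT_comp (@measurable_tnth _ RR n i)).
Qed.

Let dist0 i w : (0 <= dist i w)%R. Proof. exact: normr_ge0. Qed.

Let distS i u : `|tnth (X u) (lift ord0 i) - tnth (Y u) (lift ord0 i)|%R = dist i u.1.
Proof. by rewrite !tnthS. Qed.

Let mhead : measurable_fun setT (fun u : T * (RR * RR) => `|u.2.1 - u.2.2|%R : R).
Proof.
apply: (measurableT_comp (@normr_measurable R setT)).
by apply: measurable_funB => /=; apply: measurableT_comp.
Qed.

Let integral_le_cst (c : \bar R) (A B : RR -> \bar R) : 0 <= c ->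
  measurable_fun setT A -> (forall y, 0 <= A y) ->
  measurable_fun setT B -> (forall y, 0 <= B y) ->
  (forall y, A y <= c + B y) -> \int[mu]_y A y <= c + \int[mu]_y B y.
Proof.
move=> c0 mA A0 mB B0 AB.
have -> : c + \int[mu]_y B y = \int[mu]_y (c + B y).
  by rewrite ge0_integralD// integral_cst_probability.
by apply: ge0_le_integral => //; apply: emeasurable_funD.
Qed.

Let maxcoup0 w (G : RR * RR -> \bar R) : (forall u, 0 <= G u) ->
  0 <= maxcoup mu (fun x => fT (w, x)) G.
Proof.
apply: maxcoup_ge0 => //.
by apply: (measurableT_comp mfT); exact: pair1_measurable.
Qed.

(* Head: the one-coordinate bound for each [w]. Tails: the head of [X] is
   independent of [w], so it can be fixed to [y], and the bound for the tails is
   applied to [phi (y, .)]. *)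
Let costX (L : R) (phi : 'I_n.+1 -> Rn R n.+1 -> R) : (0 <= L)%R ->
  (forall i, measurable_fun setT (phi i)) -> (forall i x, (0 <= phi i x)%R) ->
  \sum_(i < n.+1) \int[Pr']_w (2 * `|tnth (X w) i - tnth (Y w) i| * phi i (X w))%:E <=
  (28 * K ^+ 2 * (1 + L))%:E * \int[P]_x (ent (F x))%:E +
  (28 * K ^+ 2 * expR (- L) * n.+1%:R)%:E +
  \sum_(i < n.+1) \int[Pr']_w (phi i (X w) ^+ 2)%:E.
Proof.
move=> L0 mphi phi0; rewrite !big_ord_recl.
have kL : (0 <= k * (1 + L))%R by rewrite mulr_ge0// addr_ge0.
have ks : (0 <= k * expR (- L))%R by rewrite mulr_ge0// expR_ge0.
have mphi2 i : measurable_fun setT (fun u : T * RR => phi i (cons2 (X' u.1, u.2))).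
  exact: measurableT_comp.
pose sq i (u : T * RR) := (phi i (cons2 (X' u.1, u.2)) ^+ 2)%:E.
have msq i : measurable_fun setT (sq i).
  by apply/measurable_EFinP; exact: measurable_funX.
have sq0 i u : 0 <= sq i u by rewrite lee_fin sqr_ge0.
have mFsq i := measurable_fun_fubini_tonelli_F (m2 := mu) _ (msq i) (sq0 i).
have mGsq i := measurable_fun_fubini_tonelli_G (m1 := Pr) _ (msq i) (sq0 i).
have sqE i : \int[Pr']_w (phi i (X w) ^+ 2)%:E = \int[Pr]_w \int[mu]_y sq i (w, y).
  exact: (Pr'_fst (G := sq i)).
apply: assemble => //.
- have mG : measurable_fun setT (fun u : T * (RR * RR) =>
      (2 * `|u.2.1 - u.2.2| * phi ord0 (X u))%:E).
    apply/measurable_EFinP; apply: measurable_funM; last exact: measurableT_comp.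
    exact: measurable_funM.
  have G0 (u : T * (RR * RR)) : 0 <= (2 * `|u.2.1 - u.2.2| * phi ord0 (X u))%:E.
    by rewrite lee_fin !mulr_ge0.
  rewrite Pr'E// sqE -integral_affine//;
    [|exact: (mFsq ord0)|by move=> w; exact: integral_ge0].
  apply: ge0_le_integral => //.
  + by move=> w _; apply: maxcoup0 => u; rewrite lee_fin !mulr_ge0.
  + exact: (measurable_maxcoup mu mfT fT0 mG G0).
  + by apply: mbound; exact: (mFsq ord0).
  + move=> w _; rewrite hE; apply: (@weak_cost_fst R K mu K0 psi (fun y => fT (w, y))
      _ _ _ (fun y => phi ord0 (cons2 (X' w, y))) L) => //.
    * by apply: (measurableT_comp mfT); exact: pair1_measurable.
    * exact: (measurableT_comp (mphi2 ord0) (pair1_measurable w)).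
pose A (i : 'I_n) (u : T * RR) :=
  (2 * dist i u.1 * phi (lift ord0 i) (cons2 (X' u.1, u.2)))%:E.
have mA i : measurable_fun setT (A i).
  apply/measurable_EFinP; apply: measurable_funM => //.
  by apply: measurable_funM => //; exact: (measurableT_comp (mdist i)).
have A0 i u : 0 <= A i u by rewrite lee_fin !mulr_ge0.
have mGA i := measurable_fun_fubini_tonelli_G (m1 := Pr) _ (mA i) (A0 i).
have AE i : \int[Pr']_w (2 * `|tnth (X w) (lift ord0 i) - tnth (Y w) (lift ord0 i)| *
    phi (lift ord0 i) (X w))%:E = \int[mu]_y \int[Pr]_w A i (w, y).
  under eq_integral do rewrite distS.
  rewrite (Pr'_fst (G := A i))//.
  exact: (fubini_tonelli (m1 := Pr) (m2 := mu) (A i)).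
rewrite (eq_bigr _ (fun i _ => AE i)).
have sqE' i : \int[Pr']_w (phi i (X w) ^+ 2)%:E = \int[mu]_y \int[Pr]_w sq i (w, y).
  rewrite sqE; exact: (fubini_tonelli (m1 := Pr) (m2 := mu) (sq i)).
rewrite [X in _ <= _ + X](eq_bigr _ (fun i _ => sqE' (lift ord0 i))).
rewrite -!ge0_integral_sum//; last 2 first.
- by move=> i y _; exact: integral_ge0.
- by move=> i y _; exact: integral_ge0.
apply: integral_le_cst.
- by rewrite adde_ge0 ?mule_ge0 ?lee_fin// mulr_ge0.
- by apply: emeasurable_sum => i; exact: mGA.
- by move=> y; apply: sume_ge0 => i _; exact: integral_ge0.
- by apply: emeasurable_sum => i; exact: mGsq.
- by move=> y; apply: sume_ge0 => i _; exact: integral_ge0.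
move=> y; apply: (tc_costX gc (phi := fun i x => phi (lift ord0 i) (cons2 (x, y)))) => //.
  move=> i; apply: (measurableT_comp (mphi (lift ord0 i))).
  by apply: (measurableT_comp mcons); exact: pair2_measurable.
by move=> i; exact: (mGsq (lift ord0 i)).
Qed.

(* Given the tail [z] of [Y], its head has density [f (z, .)] and is independent
   of the tail of [X], so that [phi] may be replaced by its mean [psi_]. *)
Let costY (L M : R) (phi : 'I_n.+1 -> Rn R n.+1 -> R) : (0 <= L)%R ->
  (forall i, measurable_fun setT (phi i)) -> (forall i x, (0 <= phi i x <= M)%R) ->
  \sum_(i < n.+1) \int[Pr']_w (2 * `|tnth (X w) i - tnth (Y w) i| * phi i (Y w))%:E <=
  (28 * K ^+ 2 * (1 + L))%:E * \int[P]_x (ent (F x))%:E +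
  (28 * K ^+ 2 * expR (- L) * n.+1%:R)%:E +
  \sum_(i < n.+1) \int[Pr']_w (phi i (Y w) ^+ 2)%:E.
Proof.
move=> L0 mphi phiM; rewrite !big_ord_recl.
have phi0 i x : (0 <= phi i x)%R by have /andP[] := phiM i x.
have kL : (0 <= k * (1 + L))%R by rewrite mulr_ge0// addr_ge0.
have ks : (0 <= k * expR (- L))%R by rewrite mulr_ge0// expR_ge0.
have mpc i : measurable_fun setT (fun u => phi i (cons2 u)) by exact: measurableT_comp.
have mphi2 i : measurable_fun setT (fun u : T * RR => phi i (cons2 (Y' u.1, u.2))).
  exact: measurableT_comp.
have mpz i z : measurable_fun setT (fun y => phi i (cons2 (z, y))).
  exact: (measurableT_comp (mpc i) (pair1_measurable z)).
pose sq i (u : T * RR) := (f (Y' u.1, u.2) * phi i (cons2 (Y' u.1, u.2)) ^+ 2)%:E.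
have msq i : measurable_fun setT (sq i).
  by apply/measurable_EFinP; apply: measurable_funM => //; exact: measurable_funX.
have sq0 i u : 0 <= sq i u by rewrite lee_fin mulr_ge0// sqr_ge0.
have mFsq i := measurable_fun_fubini_tonelli_F (m2 := mu) _ (msq i) (sq0 i).
have sqE i : \int[Pr']_w (phi i (Y w) ^+ 2)%:E = \int[Pr]_w \int[mu]_y sq i (w, y).
  rewrite (Pr'_snd (G := fun u => (phi i (cons2 (Y' u.1, u.2)) ^+ 2)%:E)).
  - by [].
  - by apply/measurable_EFinP; exact: measurable_funX.
  - by move=> u; rewrite lee_fin sqr_ge0.
apply: assemble => //.
- have mG : measurable_fun setT (fun u : T * (RR * RR) =>
      (2 * `|u.2.1 - u.2.2| * phi ord0 (Y u))%:E).
    apply/measurable_EFinP; apply: measurable_funM; last exact: measurableT_comp.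
    exact: measurable_funM.
  have G0 (u : T * (RR * RR)) : 0 <= (2 * `|u.2.1 - u.2.2| * phi ord0 (Y u))%:E.
    by rewrite lee_fin !mulr_ge0.
  rewrite Pr'E// sqE -integral_affine//;
    [|exact: (mFsq ord0)|by move=> w; exact: integral_ge0].
  apply: ge0_le_integral => //.
  + by move=> w _; apply: maxcoup0 => u; rewrite lee_fin !mulr_ge0.
  + exact: (measurable_maxcoup mu mfT fT0 mG G0).
  + by apply: mbound; exact: (mFsq ord0).
  + move=> w _; rewrite hE; apply: (@weak_cost_snd R K mu K0 psi (fun y => fT (w, y))
      _ _ _ (fun y => phi ord0 (cons2 (Y' w, y))) L) => //.
    by apply: (measurableT_comp mfT); exact: pair1_measurable.
pose psi_ (i : 'I_n) (z : Rn R n) : R :=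
  weighted_mean mu (fun y => f (z, y)) (fun y => phi (lift ord0 i) (cons2 (z, y))).
have mfpc i : measurable_fun setT (fun u => (f u * phi (lift ord0 i) (cons2 u))%:E).
  by apply/measurable_EFinP; exact: measurable_funM.
have mpsi i : measurable_fun setT (psi_ i).
  apply: (measurableT_comp (@fine_measurable R setT measurableT)).
  apply: (measurable_fun_fubini_tonelli_F (m2 := mu) _ (mfpc i)).
  by move=> u; rewrite lee_fin mulr_ge0.
have AE i : \int[Pr']_w (2 * `|tnth (X w) (lift ord0 i) - tnth (Y w) (lift ord0 i)| *
    phi (lift ord0 i) (Y w))%:E = \int[Pr]_w (2 * dist i w * psi_ i (Y' w))%:E.
  under eq_integral do rewrite distS.
  rewrite (Pr'_snd (G := fun u => (2 * dist i u.1 * phi (lift ord0 i) (cons2 (Y' u.1, u.2)))%:E)).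
  - apply: eq_integral => w _.
    under eq_integral do rewrite -EFinM mulrCA EFinM.
    rewrite /=.
    rewrite ge0_integralZl//.
    + by rewrite (integral_weighted_mean (M := M))// -EFinM.
    + by apply/measurable_EFinP; exact: measurable_funM.
    + by move=> y _; rewrite lee_fin mulr_ge0.
    + by rewrite lee_fin mulr_ge0.
  - apply/measurable_EFinP; apply: measurable_funM => //.
    by apply: measurable_funM => //; exact: (measurableT_comp (mdist i)).
  - by move=> u; rewrite lee_fin !mulr_ge0.
rewrite (eq_bigr _ (fun i _ => AE i)).
apply: (le_trans (tc_costY gc (M := M) L0 mpsi _)).
  by move=> i z; exact: weighted_mean_itv.
rewrite leeD2l//; apply: lee_sum => i _; rewrite sqE.
apply: ge0_le_integral => //.
- by move=> w _; rewrite lee_fin sqr_ge0.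
- by apply/measurable_EFinP; apply: measurable_funX; exact: (measurableT_comp (mpsi i)).
- exact: (mFsq (lift ord0 i)).
- by move=> w _; apply: (sqr_weighted_mean_le (M := M)).
Qed.

Let costE (r : R) : (0 < r)%R ->
  \sum_(i < n.+1) \int[Pr']_w (`|tnth (X w) i - tnth (Y w) i| ^+ 2)%:E <=
  (K ^+ 2 * (20 / r + 18))%:E * \int[P]_x (ent (F x))%:E +
  (K ^+ 2 * (8 * r) * n.+1%:R)%:E.
Proof.
move=> r0; rewrite big_ord_recl -[leRHS]adde0 -[X in _ <= _ + X]adde0.
have kL : (0 <= K ^+ 2 * (20 / r + 18))%R.
  by rewrite mulr_ge0 ?sqr_ge0// addr_ge0// divr_ge0// ltW.
have ks : (0 <= K ^+ 2 * (8 * r))%R by rewrite !mulr_ge0 ?sqr_ge0// ltW.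
apply: assemble => //; rewrite adde0; last first.
  have E i : \int[Pr']_w (`|tnth (X w) (lift ord0 i) - tnth (Y w) (lift ord0 i)| ^+ 2)%:E =
      \int[Pr]_w (dist i w ^+ 2)%:E.
    under eq_integral do rewrite distS.
    rewrite (Pr'_fst (G := fun u => (dist i u.1 ^+ 2)%:E)).
    + apply: eq_integral => w _ /=.
      by rewrite integral_cst_probability.
    + apply/measurable_EFinP; apply: measurable_funX.
      exact: (measurableT_comp (mdist i)).
    + by move=> u; rewrite lee_fin sqr_ge0.
  rewrite (eq_bigr _ (fun i _ => E i)); exact: (tc_costE gc).
have mG : measurable_fun setT (fun u : T * (RR * RR) => (`|u.2.1 - u.2.2| ^+ 2)%:E).
  by apply/measurable_EFinP; exact: measurable_funX.
have G0 (u : T * (RR * RR)) : 0 <= (`|u.2.1 - u.2.2| ^+ 2)%:E.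
  by rewrite lee_fin sqr_ge0.
rewrite Pr'E// -[leRHS]adde0 -(integral0 Pr setT) -integral_affine//.
apply: ge0_le_integral => //.
- by move=> w _; apply: maxcoup0 => u; rewrite lee_fin sqr_ge0.
- exact: (measurable_maxcoup mu mfT fT0 mG G0).
- exact: mbound.
- move=> w _; rewrite adde0 hE; apply: (@sqr_cost R K mu K0 psi (fun y => fT (w, y))) => //.
  by apply: (measurableT_comp mfT); exact: pair1_measurable.
Qed.

Lemma transport_coupling_step : transport_coupling K P F Pr' X Y.
Proof. by split. Qed.

End Step.

(** * Existence of the coupling *)

(** For [n = 0] there is a single point, so [F = 1] and [X = Y]. *)
Lemma exists_transport_coupling (R : realType) (K : R) (n : nat)
    (mu : 'I_n -> probability (measurableTypeR R) R)
    (P : probability (Rn R n) R) (F : Rn R n -> R) :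
  (0 < K)%R -> (forall i, psi2_norm_le (mu i) K) -> is_product_measure mu P ->
  measurable_fun setT F -> (forall x, (0 <= F x)%R) -> \int[P]_x (F x)%:E = 1 ->
  exists (d : measure_display) (T : measurableType d) (Pr : probability T R)
    (X Y : T -> Rn R n), transport_coupling K P F Pr X Y.
Proof.
move=> K0; have K2 := sqr_ge0 K; elim: n => [|n IH] in mu P F *.
  move=> _ _ mF F0 F1.
  have Fc x : F x = 1%R.
    have Fx y : F y = F x by rewrite (tuple0 x) (tuple0 y).
    move: F1; rewrite (eq_integral (fun=> (F x)%:E)); last by move=> y _; rewrite Fx.
    by rewrite integral_cst_probability => -[].
  exists _, _, P, id, id; split => //.
  - by move=> g mg g0; apply: eq_integral => x _; rewrite Fc mul1e.
  - move=> L phi L0 _ _; rewrite !big_ord0 mulr0 !adde0 mule_ge0//.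
      by rewrite lee_fin; nra.
    by apply: integral_ge0 => x _; rewrite lee_fin ent_ge0.
  - move=> L M phi L0 _ _; rewrite !big_ord0 mulr0 !adde0 mule_ge0//.
      by rewrite lee_fin; nra.
    by apply: integral_ge0 => x _; rewrite lee_fin ent_ge0.
  - move=> r r0; rewrite !big_ord0 mulr0 adde0 mule_ge0//.
      by rewrite lee_fin; have : (0 <= 20 / r)%R; [rewrite divr_ge0// ltW|nra].
    by apply: integral_ge0 => x _; rewrite lee_fin ent_ge0.
move=> psi hP mF F0 F1.
have [P' [hP' PE]] := product_measure_cons hP.
pose cons2 (u : Rn R n * measurableTypeR R) : Rn R n.+1 := [tuple of u.2 :: u.1].
have mcons : measurable_fun setT cons2 by exact: measurable_cons_pair.
pose F2 u : R := F (cons2 u).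
have mF2 : measurable_fun setT F2.
  exact: (measurableT_comp mF mcons).
have F20 u : (0 <= F2 u)%R by exact: F0.
have F21 : \int[P']_z \int[mu ord0]_y (F2 (z, y))%:E = 1.
  by rewrite -F1 PE//; exact/measurable_EFinP.
pose F' := marginal_density (mu ord0) F2.
pose f := cond_density (mu ord0) F2.
have mF' : measurable_fun setT F' by exact: measurable_marginal_density.
have F'0 z : (0 <= F' z)%R by exact: marginal_density_ge0.
have F'1 : \int[P']_z (F' z)%:E = 1 by exact: integral_marginal_density.
have mf : measurable_fun setT f by exact: measurable_cond_density.
have f0 u : (0 <= f u)%R by exact: cond_density_ge0.
have f1 z : \int[mu ord0]_y (f (z, y))%:E = 1 by exact: integral_cond_density.
have [d [T [Pr [X' [Y' gc]]]]] :=
  IH _ P' F' (fun i => psi (lift ord0 i)) hP' mF' F'0 F'1.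
pose fT (u : T * measurableTypeR R) : R := f (Y' u.1, u.2).
have mfT : measurable_fun setT fT.
  apply: (measurableT_comp mf); apply: measurable_fun_pair => //.
  exact: (measurableT_comp (tc_mY gc)).
have fT1 w : \int[mu ord0]_y (fT (w, y))%:E = 1.
  by rewrite -(f1 (Y' w)); exact: eq_integral.
have [Pr' Pr'E] := @exists_maximal_coupling _ _ _ _ _ Pr (mu ord0) fT mfT
  (fun u => f0 _) fT1.
exists _, _, Pr', (fun u => [tuple of u.2.1 :: X' u.1]), (fun u => [tuple of u.2.2 :: Y' u.1]).
apply: (transport_coupling_step K0 (psi ord0) mF F0 F'0 mf f0 f1 PE _ _ gc Pr'E (fun=> erefl)).
- exact: (integral_cond_densityM mF2 F20 F21).
- exact: (entropy_chain mF2 F20 F21).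
Qed.

(** * Relative entropy and the density of Q *)

Section EntropyDensity.
Local Open Scope charge_scope.
Context d (T : measurableType d) (R : realType) (P Q : probability T R).
Hypothesis QP : Q `<< P.

Let D := 'd (charge_of_finite_measure Q) '/d P.
(* A version of the density that is nonnegative and finite everywhere. *)
Let F x : R := fine (Radon_Nikodym_SigmaFinite.f Q P x).

Let FE x : (F x)%:E = Radon_Nikodym_SigmaFinite.f Q P x.
Proof. by rewrite fineK// Radon_Nikodym_SigmaFinite.f_fin_num. Qed.

Let F0 x : (0 <= F x)%R.
Proof. by rewrite fine_ge0// Radon_Nikodym_SigmaFinite.f_ge0. Qed.

Let mF : measurable_fun setT F.
Proof.
apply: (measurableT_comp (@fine_measurable R setT measurableT)).
exact: measurable_int (Radon_Nikodym_SigmaFinite.f_integrable QP).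
Qed.

Let changeF (g : T -> \bar R) : measurable_fun setT g -> (forall x, 0 <= g x) ->
  \int[Q]_x g x = \int[P]_x ((F x)%:E * g x).
Proof.
move=> mg g0; rewrite -(@Radon_Nikodym_SigmaFinite.change_of_variables _ _ _ Q P QP)//.
by apply: eq_integral => x _; rewrite muleC FE.
Qed.

Let F1 : \int[P]_x (F x)%:E = 1.
Proof.
transitivity (\int[Q]_x (cst 1 x)); last exact: integral_cst_probability.
by rewrite changeF//; apply: eq_integral => x _; rewrite mule1.
Qed.

Let mlnF : measurable_fun setT (fun x => ln (F x)).
Proof. exact: (measurableT_comp (@measurable_ln R)). Qed.

Let ae_lne : ae_eq Q setT (fun x => lne (D x)) (fun x => (ln (F x))%:E).
Proof.
have h1 : {ae Q, forall x, (F x)%:E = D x}.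
  have : ae_eq P setT (Radon_Nikodym_SigmaFinite.f Q P) D.
    exact: ae_eq_Radon_Nikodym_SigmaFinite.
  move=> [N [mN N0 subN]]; exists N; split => //.
    by move/null_content_dominatesP : QP; apply.
  move=> x /= h; apply: subN => /= h'; apply: h; rewrite FE; exact: h'.
have h2 : {ae Q, forall x, (0 < F x)%R}.
  exists [set x | (F x <= 0)%R]; split.
  - rewrite -[X in measurable X]setTI; apply: measurable_fun_le => //.
  - have m0 : measurable [set x | (F x <= 0)%R].
      by rewrite -[X in measurable X]setTI; apply: measurable_fun_le.
    rewrite (Radon_Nikodym_SigmaFinite.f_integral QP)//.
    rewrite (eq_integral (cst 0)) ?integral0// => x; rewrite inE /= => xF.
    by rewrite -FE; congr EFin; apply/eqP; rewrite eq_le xF F0.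
  - by move=> x /=; rewrite leNgt => /negP.
move: h1 h2; apply: filterS2 => x h1 h2 _.
by rewrite -h1 lne_EFin.
Qed.

Variable H : R.
Hypothesis QH : relative_entropy Q P = H%:E.

Let lnFE : \int[Q]_x (ln (F x))%:E = H%:E.
Proof.
rewrite -QH; symmetry; apply: ae_eq_integral => //.
- have Dfin x : D x \is a fin_num.
    apply: Radon_Nikodym_fin_num; exact: QP.
  have -> : (fun x => lne (D x)) =
      (fun x => if (fine (D x) <= 0)%R then -oo else (ln (fine (D x)))%:E).
    by apply/funext => x; rewrite -{1}(fineK (Dfin x)).
  have mD : measurable_fun setT (fun x => fine (D x)).
    apply: (measurableT_comp (@fine_measurable R setT measurableT)).
    by apply: (measurable_int P); apply: Radon_Nikodym_integrable; exact: QP.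
  apply: measurable_fun_ifT => //.
    exact: (@measurable_fun_ler _ _ _ setT (fun x => fine (D x)) (cst 0%R)).
  by apply/measurable_EFinP; exact: (measurableT_comp (@measurable_ln R)).
- exact/measurable_EFinP.
Qed.

(** Changing variables, the entropy is the integral of [F ln F] against [P]. As
    [H] is finite, the positive and negative parts of [ln F] both have finite
    integral against [Q], and they can be moved to opposite sides. *)
Lemma integral_ent_density : \int[P]_x (ent (F x))%:E = H%:E.
Proof.
pose lp x : R := Num.max (ln (F x)) 0%R.
pose lm x : R := Num.max (- ln (F x))%R 0%R.
have lp0 x : (0 <= lp x)%R by rewrite /lp le_max lexx orbT.
have lm0 x : (0 <= lm x)%R by rewrite /lm le_max lexx orbT.
have mlp : measurable_fun setT lp by exact: measurable_maxr.
have mlm : measurable_fun setT lm by apply: measurable_maxr => //; exact: measurableT_comp.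
have lE x : (ln (F x) = lp x - lm x)%R.
  by rewrite /lp /lm; case: (leP 0 (ln (F x)))%R; case: (leP 0 (- ln (F x)))%R; lra.
have QE : \int[Q]_x (lp x)%:E - \int[Q]_x (lm x)%:E = H%:E.
  rewrite -lnFE [RHS]integralE; congr (_ - _); apply: eq_integral => x _.
    by rewrite funeposE /lp EFin_max.
  by rewrite funenegE /lm EFin_max EFinN.
have mlpE : measurable_fun setT (EFin \o lp) by exact/measurable_EFinP.
have mlmE : measurable_fun setT (EFin \o lm) by exact/measurable_EFinP.
have := QE; rewrite (changeF mlpE) ?(changeF mlmE)//=.
set Ip := \int[P]_x _; set Im := \int[P]_x _ => IE.
have Ip0 : 0 <= Ip by apply: integral_ge0 => x _; rewrite -EFinM lee_fin mulr_ge0.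
have Im0 : 0 <= Im by apply: integral_ge0 => x _; rewrite -EFinM lee_fin mulr_ge0.
have mFE : measurable_fun setT (EFin \o F) by exact/measurable_EFinP.
have meE : measurable_fun setT (fun x => (ent (F x))%:E).
  by apply/measurable_EFinP; exact: measurable_ent.
have mp : measurable_fun setT (fun x => (F x)%:E * (lp x)%:E) by exact: emeasurable_funM.
have mm : measurable_fun setT (fun x => (F x)%:E * (lm x)%:E) by exact: emeasurable_funM.
have e0 x : 0 <= (ent (F x))%:E by rewrite lee_fin ent_ge0.
have p0 x : 0 <= (F x)%:E * (lp x)%:E by rewrite -EFinM lee_fin mulr_ge0.
have m0 x : 0 <= (F x)%:E * (lm x)%:E by rewrite -EFinM lee_fin mulr_ge0.
have : \int[P]_x ((ent (F x))%:E + ((F x)%:E + (F x)%:E * (lm x)%:E)) =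
       \int[P]_x ((F x)%:E * (lp x)%:E + 1).
  apply: eq_integral => x _; rewrite -!EFinM -!EFinD; congr EFin.
  by rewrite /ent lE; ring.
rewrite ge0_integralD//; [|by move=> x _; rewrite adde_ge0// lee_fin|exact: emeasurable_funD].
rewrite ge0_integralD//; last by move=> x _; rewrite lee_fin.
rewrite ge0_integralD// integral_cst_probability F1 -/Ip -/Im.
move: IE Ip0 Im0; case: Ip Im => [ip| |] [im| |]//= [<-] _ _.
case: (\int[P]_x (ent (F x))%:E) => [e| |]//=.
by rewrite -!EFinD => -[] eq; congr EFin; lra.
Qed.

Lemma exists_density : exists f : T -> R, [/\ measurable_fun setT f,
  (forall x, (0 <= f x)%R),
  (forall g : T -> \bar R, measurable_fun setT g -> (forall x, 0 <= g x) ->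
    \int[Q]_x g x = \int[P]_x ((f x)%:E * g x)) &
  \int[P]_x (ent (f x))%:E = H%:E].
Proof. by exists F; split => //; exact: integral_ent_density. Qed.

End EntropyDensity.

(** * Conditional expectations *)

Section ImageMeasure.
Context d d' (T : measurableType d) (T' : measurableType d') (R : realType).
Variables (nu : {finite_measure set T -> \bar R}) (X : T -> T').
Hypothesis mX : measurable_fun setT X.

(** Image of a finite measure, as a finite measure; the measurability of [X] is
    an argument because the structure needs it. *)
Definition image_measure of measurable_fun setT X := fun A => nu (X @^-1` A).

Local Notation img := (image_measure mX).

Let img0 : img set0 = 0. Proof. by rewrite /image_measure preimage_set0 measure0. Qed.
Let img_ge0 A : 0 <= img A. Proof. exact: measure_ge0. Qed.
Let img_sigma_additive : semi_sigma_additive img.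
Proof.
pose X' : {mfun T >-> T'} := mfun_Sub (mem_set mX).
exact: (@measure_semi_sigma_additive _ _ _ (pushforward nu X')).
Qed.

HB.instance Definition _ := isMeasure.Build _ _ _ img img0 img_ge0 img_sigma_additive.

Let img_fin : fin_num_fun img.
Proof.
move=> A mA; apply: fin_num_measure; rewrite -[X in measurable X]setTI.
exact: mX.
Qed.

HB.instance Definition _ := Measure_isFinite.Build _ _ _ img img_fin.

End ImageMeasure.

(** [u] is the Radon-Nikodym derivative of the image under [X] of the measure
    [W Pr] with respect to the law of [X]. The last clause extends the defining
    property from events to test functions, for use by duality. *)
Lemma exists_cond_exp d d' (T : measurableType d) (T' : measurableType d')
    (R : realType) (Pr : probability T R) (X : {RV Pr >-> T'}) (W : T -> R) :
  measurable_fun setT W -> (forall w, (0 <= W w)%R) ->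
  \int[Pr]_w (W w)%:E < +oo ->
  exists u : T' -> R, [/\ measurable_fun setT u, (forall x, (0 <= u x)%R),
    is_cond_exp W X (u \o X) &
    forall phi : T' -> R, measurable_fun setT phi -> (forall x, (0 <= phi x)%R) ->
      \int[Pr]_w (W w * phi (X w))%:E = \int[Pr]_w (u (X w) * phi (X w))%:E].
Proof.
move=> mW W0 Woo.
have mX : measurable_fun setT X by exact: measurable_funPT.
have WE0 w : 0 <= (W w)%:E by rewrite lee_fin.
have iW : Pr.-integrable setT (EFin \o W).
  apply/integrableP; split; first exact/measurable_EFinP.
  by rewrite (eq_integral (fun w => (W w)%:E))// => w _; rewrite /= ger0_norm.
pose nW := density_measure WE0 iW.
pose nu := image_measure nW mX.
pose law := distribution Pr X.
have nulaw : nu `<< law.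
  apply/null_content_dominatesP => A mA A0.
  have mXA : measurable (X @^-1` A) by rewrite -[X in measurable X]setTI; exact: (mX).
  rewrite /= /image_measure /= /density_measure.
  rewrite -(@integral_abs_eq0 _ _ _ Pr (X @^-1` A) (EFin \o W))//.
    by apply: eq_integral => w _; rewrite /= ger0_norm.
  by apply: measurable_funTS; exact/measurable_EFinP.
pose u x : R := fine (Radon_Nikodym_SigmaFinite.f nu law x).
have uE x : (u x)%:E = Radon_Nikodym_SigmaFinite.f nu law x.
  by rewrite fineK// Radon_Nikodym_SigmaFinite.f_fin_num.
have u0 x : (0 <= u x)%R by rewrite fine_ge0// Radon_Nikodym_SigmaFinite.f_ge0.
have mu_ : measurable_fun setT u.
  apply: (measurableT_comp (@fine_measurable R setT measurableT)).
  exact: measurable_int (Radon_Nikodym_SigmaFinite.f_integrable nulaw).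
have key (g : T' -> \bar R) : measurable_fun setT g -> (forall x, 0 <= g x) ->
    \int[Pr]_w (g (X w) * (W w)%:E) = \int[Pr]_w (g (X w) * (u (X w))%:E).
  move=> mg g0.
  transitivity (\int[nu]_x g x).
    transitivity (\int[nW]_w g (X w)).
      rewrite [RHS](ge0_integral_density WE0 iW)//; exact: (measurableT_comp mg mX).
    by rewrite (ge0_integral_pushforward mX).
  rewrite -(@Radon_Nikodym_SigmaFinite.change_of_variables _ _ _ nu law nulaw)//.
  under eq_integral do rewrite -uE.
  rewrite ge0_integral_distribution//.
    by apply: emeasurable_funM => //; exact/measurable_EFinP.
  by move=> x; rewrite mule_ge0// lee_fin.
have key' (phi : T' -> R) : measurable_fun setT phi -> (forall x, (0 <= phi x)%R) ->
      \int[Pr]_w (W w * phi (X w))%:E = \int[Pr]_w (u (X w) * phi (X w))%:E.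
  move=> mphi phi0.
  under eq_integral do rewrite mulrC EFinM.
  under [RHS]eq_integral do rewrite mulrC EFinM.
  apply: (key (fun x => (phi x)%:E)).
    exact/measurable_EFinP.
  by move=> x; rewrite lee_fin.
exists u; split => //.
have muX : measurable_fun setT (u \o X) by exact: (measurableT_comp mu_ mX).
split => //.
- apply/integrableP; split; first exact/measurable_EFinP.
 rewrite (eq_integral (fun w => (u (X w))%:E)); last first.
    by move=> w _; rewrite /= ger0_norm.
  rewrite (_ : \int[Pr]_w _ = \int[Pr]_w (W w)%:E)//.
  transitivity (\int[Pr]_w (u (X w) * cst 1%R (X w))%:E).
    by apply: eq_integral => w _; rewrite /= mulr1.
  rewrite -key'//; by apply: eq_integral => w _; rewrite /= mulr1.
- move=> B mB; exists (u @^-1` B); last by rewrite setTI.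
  by rewrite -[X in measurable X]setTI; exact: (mu_).
- move=> _ [B mB <-]; rewrite setTI.
  have mXB : measurable (X @^-1` B) by rewrite -[X in measurable X]setTI; exact: (mX).
  have E (h : T -> R) : \int[Pr]_(w in X @^-1` B) (h w)%:E =
      \int[Pr]_w ((\1_B (X w))%:E * (h w)%:E).
    rewrite integral_mkcond; apply: eq_integral => w _.
    rewrite patchE indicE (_ : (w \in _) = (X w \in B))//.
    by case: ifPn; rewrite ?mul1e ?mul0e.
  rewrite !E; symmetry; apply: (key (fun x => (\1_B x)%:E)).
    by apply/measurable_EFinP; exact: measurable_indic.
  by move=> x; rewrite lee_fin.
Qed.

(** Monotone convergence, the truncations being eventually constant. *)
Lemma le_sum_integral_of_truncation d (T : measurableType d) (R : realType)
    (Pr : probability T R) (n : nat) (v : 'I_n -> T -> R) (B : \bar R) :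
  (forall i, measurable_fun setT (v i)) -> (forall i w, (0 <= v i w)%R) ->
  (forall M : nat, \sum_(i < n) \int[Pr]_w (Num.min (v i w) M%:R ^+ 2)%:E <= B) ->
  \sum_(i < n) \int[Pr]_w (v i w ^+ 2)%:E <= B.
Proof.
move=> mv v0 HB.
pose V M w := (\sum_(i < n) Num.min (v i w) M%:R ^+ 2)%R.
have min0 i w M : (0 <= Num.min (v i w) M%:R)%R by rewrite le_min v0/=.
have mm i M : measurable_fun setT (fun w => Num.min (v i w) M%:R ^+ 2)%R.
  by apply: measurable_funX; exact: measurable_minr.
have mV M : measurable_fun setT (fun w => (V M w)%:E).
  by apply/measurable_EFinP; apply: measurable_sum.
have V0 M w : 0 <= (V M w)%:E by rewrite lee_fin sumr_ge0// => i _; exact: sqr_ge0.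
have ndV w : {homo (fun M => (V M w)%:E) : a b / (a <= b)%N >-> a <= b}.
  move=> a b ab; rewrite lee_fin; apply: ler_sum => i _.
  rewrite ler_sqr ?nnegrE//.
  by rewrite le_min ge_min lexx/= ge_min ler_nat ab orbT.
have sumE (f : 'I_n -> T -> R) : (forall i, measurable_fun setT (f i)) ->
    (forall i w, (0 <= f i w)%R) ->
    \sum_(i < n) \int[Pr]_w (f i w)%:E = \int[Pr]_w (\sum_(i < n) f i w)%:E.
  move=> mf f0; rewrite -ge0_integral_sum//.
  - by apply: eq_integral => w _; rewrite sumEFin.
  - by move=> i; exact/measurable_EFinP.
  - by move=> i w _; rewrite lee_fin.
rewrite sumE; last 2 first.
- by move=> i; exact: measurable_funX.
- by move=> i w; exact: sqr_ge0.
rewrite (eq_integral (fun w => limn (fun M => (V M w)%:E))); last first.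
  move=> w _; apply/esym/cvg_lim => //; apply: cvg_near_cst.
  exists (Num.bound (\sum_(i < n) v i w)%R) => // M /= NM.
  rewrite /V; congr EFin; apply: eq_bigr => i _; congr (_ ^+ 2)%R.
  apply/min_idPl.
  have : (v i w <= \sum_(i < n) v i w)%R.
    by rewrite (bigD1 i)//= lerDl sumr_ge0.
  move=> /le_trans; apply.
  have s0 : (0 <= \sum_(i < n) v i w)%R by rewrite sumr_ge0.
  by rewrite (le_trans (ltW (archi_boundP s0)))// ler_nat.
rewrite monotone_convergence//.
apply: lime_le.
  apply: ereal_nondecreasing_is_cvgn => a b ab; apply: ge0_le_integral => //.
  by move=> w _; exact: ndV.
by apply: nearW => M; rewrite -sumE// => i w; exact: sqr_ge0.
Qed.

(** * Duality and choice of the parameters *)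

(** Apply the dual bound to [phi i = min (u i) M]. The left-hand side is the
    integral of [2 u phi >= 2 phi ^ 2], and the integral of [phi ^ 2] is finite
    because [phi] is bounded, so that it can be cancelled. Then [M] tends to
    infinity. *)
Lemma sqr_cond_exp_bound d d' (T : measurableType d) (T' : measurableType d')
    (R : realType) (Pr : probability T R) (X : T -> T') (n : nat)
    (W : 'I_n -> T -> R) (u : 'I_n -> T' -> R) (B : R) :
  measurable_fun setT X ->
  (forall i, measurable_fun setT (u i)) -> (forall i x, (0 <= u i x)%R) ->
  (forall i (phi : T' -> R), measurable_fun setT phi -> (forall x, (0 <= phi x)%R) ->
    \int[Pr]_w (W i w * phi (X w))%:E = \int[Pr]_w (u i (X w) * phi (X w))%:E) ->
  (forall (M : R) (phi : 'I_n -> T' -> R),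
    (forall i, measurable_fun setT (phi i)) -> (forall i x, (0 <= phi i x <= M)%R) ->
    \sum_(i < n) \int[Pr]_w (2 * W i w * phi i (X w))%:E <=
      B%:E + \sum_(i < n) \int[Pr]_w (phi i (X w) ^+ 2)%:E) ->
  \sum_(i < n) \int[Pr]_w (u i (X w) ^+ 2)%:E <= B%:E.
Proof.
move=> mX mu_ u0 key dual.
apply: (@le_sum_integral_of_truncation _ _ _ _ _ (fun i w => u i (X w))) => //.
  by move=> i; exact: (measurableT_comp (mu_ i)).
move=> M.
pose phi i x : R := Num.min (u i x) M%:R.
have mphi i : measurable_fun setT (phi i) by exact: measurable_minr.
have phi0 i x : (0 <= phi i x)%R by rewrite le_min u0/=.
have phiM i x : (0 <= phi i x <= M%:R)%R by rewrite phi0/= ge_min lexx orbT.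
have mphiX i : measurable_fun setT (fun w => phi i (X w)).
  exact: (measurableT_comp (mphi i)).
have msq i : measurable_fun setT (fun w => (phi i (X w) ^+ 2)%:E).
  by apply/measurable_EFinP; exact: measurable_funX.
have sq0 i w : 0 <= (phi i (X w) ^+ 2)%:E by rewrite lee_fin sqr_ge0.
pose s i := \int[Pr]_w (phi i (X w) ^+ 2)%:E.
have s_le i : s i <= (M%:R ^+ 2)%:E.
  rewrite -[leRHS](integral_cst_probability Pr).
  apply: ge0_le_integral => // w _; rewrite lee_fin ler_sqr ?nnegrE//.
  by have /andP[] := phiM i (X w).
have s0 i : 0 <= s i by exact: integral_ge0.
have double i : s i + s i <= \int[Pr]_w (2 * W i w * phi i (X w))%:E.
  have -> : \int[Pr]_w (2 * W i w * phi i (X w))%:E =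
      \int[Pr]_w (u i (X w) * (2 * phi i (X w)))%:E.
    rewrite -(key i (fun x => 2 * phi i x)%R).
    - by apply: eq_integral => w _; congr EFin; ring.
    - exact: measurable_funM.
    - by move=> x; rewrite mulr_ge0.
  rewrite -ge0_integralD//; apply: ge0_le_integral => //.
  - by move=> w _; rewrite adde_ge0.
  - exact: emeasurable_funD.
  - apply/measurable_EFinP; apply: measurable_funM; last exact: measurable_funM.
    exact: (measurableT_comp (mu_ i)).
  - move=> w _; rewrite -EFinD lee_fin.
    have : (phi i (X w) <= u i (X w))%R by rewrite ge_min lexx.
    have := phi0 i (X w); nra.
have fin : \sum_(i < n) s i \is a fin_num.
  apply/sum_fin_numP => i _ _; rewrite ge0_fin_numE//.
  by rewrite (le_lt_trans (s_le i))// ltry.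
rewrite -/(\sum_(i < n) s i) -(@leeD2rE _ (\sum_(i < n) s i))//.
apply: le_trans (dual M%:R phi mphi phiM).
by rewrite -big_split/=; apply: lee_sum => i _; exact: double.
Qed.

Section Optimisation.
Context {R : realType}.
Implicit Types (K H r L : R) (n : nat) (x : \bar R).

(** The choice [L = ln (e + n / H) >= 1] gives [exp (- L) n <= H], hence the
    constant [1 + 1 + 1 = 3]. For [H = 0] let [L] tend to infinity. *)
Lemma le_Psi (c : R) n H x : (0 <= c)%R -> (0 <= H)%R -> 0 <= x ->
  (forall L, (0 <= L)%R -> x <= (c * ((1 + L) * H + expR (- L) * n%:R))%:E) ->
  x <= (3 * c * Psi n H)%:E.
Proof.
move=> c0 H0 x0 hx; rewrite /Psi; have [HE|Hn0] := eqVneq H 0%R.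
  rewrite mulr0; apply/lee_addgt0Pr => e e0; rewrite add0e.
  have cn : (0 <= c * n%:R)%R by rewrite mulr_ge0.
  have L0 : (0 <= c * n%:R / e)%R by rewrite divr_ge0// ltW.
  apply: (le_trans (hx _ L0)); rewrite HE mulr0 add0r lee_fin.
  have e1 : (expR (- (c * n%:R / e)) * (1 + c * n%:R / e) <= 1)%R.
    rewrite expRN mulrC ler_pdivrMr ?expR_gt0// mul1r; exact: expR_ge1Dx.
  rewrite mulrCA; set E := expR _ in e1 *.
  have E0 : (0 <= E)%R by exact: expR_ge0.
  have -> : (E * (c * n%:R) = E * (c * n%:R / e) * e)%R.
    by rewrite -mulrA divfK// gt_eqF.
  by rewrite ler_piMl ?(ltW e0)//; nra.
have Hp : (0 < H)%R by rewrite lt_neqAle eq_sym Hn0.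
pose a : R := (expR 1 + n%:R / H)%R.
have nH : (0 <= n%:R / H)%R by rewrite divr_ge0.
have a0 : (0 < a)%R by rewrite ltr_wpDr// expR_gt0.
have L1 : (1 <= ln a)%R by rewrite -[leLHS]expRK ler_ln ?posrE ?expR_gt0// lerDl.
apply: (le_trans (hx (ln a) _)); first by rewrite (le_trans _ L1).
rewrite lee_fin expRN lnK ?posrE// -/a.
have h1 : (a^-1 * n%:R <= H)%R.
  rewrite mulrC ler_pdivrMr// /a mulrDr mulrCA divff// mulr1.
  by rewrite lerDr mulr_ge0// expR_ge0.
have -> : (3 * c * (H * ln a) = c * (3 * (H * ln a)))%R by ring.
rewrite ler_wpM2l//; nra.
Qed.

(** The choice [r = sqrt (H / n) = sqrt (n H) / n] balances the two terms that
    contain [r]. For [H = 0] let [r] tend to 0. *)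
Lemma le_sqrt_entropy (c : R) n H x : (0 <= c)%R -> (0 <= H)%R -> (0 < n)%N -> 0 <= x ->
  (forall r, (0 < r)%R -> x <= (c * ((20 / r + 18) * H + 8 * r * n%:R))%:E) ->
  x <= (28 * c * (Num.sqrt (n%:R * H) + H))%:E.
Proof.
move=> c0 H0 n0 x0 hx; have [HE|Hn0] := eqVneq H 0%R.
  rewrite HE mulr0 sqrtr0 addr0 mulr0; apply/lee_addgt0Pr => e e0; rewrite add0e.
  pose a : R := (c * 8 * n%:R)%R.
  have a0 : (0 <= a)%R by rewrite !mulr_ge0.
  have r0 : (0 < e / (1 + a))%R by rewrite divr_gt0// ltr_wpDr.
  apply: (le_trans (hx _ r0)); rewrite HE mulr0 add0r lee_fin.
  have -> : (c * (8 * (e / (1 + a)) * n%:R) = e * (a / (1 + a)))%R by rewrite /a; ring.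
  by rewrite ler_piMr ?(ltW e0)// ler_pdivrMr ?mul1r ?lerDr// ltr_wpDr.
have Hp : (0 < H)%R by rewrite lt_neqAle eq_sym Hn0.
have np : (0 < n%:R :> R)%R by rewrite ltr0n.
pose q : R := Num.sqrt (n%:R * H).
have q0 : (0 < q)%R by rewrite sqrtr_gt0 mulr_gt0.
have qE : (q * q = n%:R * H)%R by rewrite -expr2 sqr_sqrtr// mulr_ge0// ltW.
have r0 : (0 < q / n%:R)%R by rewrite divr_gt0.
apply: (le_trans (hx _ r0)); rewrite lee_fin.
have e : (20 / (q / n%:R) * H = 20 * q)%R.
  have HE : (H = q * q / n%:R)%R by rewrite qE mulrAC divff ?mul1r ?gt_eqF.
  rewrite [X in (_ * X)%R]HE; field; by rewrite ?gt_eqF.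
rewrite mulrDl e.
have -> : (8 * (q / n%:R) * n%:R = 8 * q)%R.
  by rewrite -mulrA divfK// gt_eqF.
rewrite -/q [(28 * c)%R]mulrC -mulrA ler_wpM2l//; lra.
Qed.

End Optimisation.

(** * The theorem *)

Lemma integral_lty_of_sqr d (T : measurableType d) (R : realType) (Pr : probability T R)
  (W : T -> R) : measurable_fun setT W -> (forall w, (0 <= W w)%R) ->
  \int[Pr]_w (W w ^+ 2)%:E < +oo -> \int[Pr]_w (W w)%:E < +oo.
Proof.
move=> mW W0 h.
apply: (@le_lt_trans _ _ (\int[Pr]_w ((W w ^+ 2)%:E + 1))).
  apply: ge0_le_integral => //.
  - by move=> w _; rewrite lee_fin.
  - exact/measurable_EFinP.
  - by apply: emeasurable_funD => //; apply/measurable_EFinP; exact: measurable_funX.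
  - move=> w _; rewrite -EFinD lee_fin; have := sqr_ge0 (W w - 1); rewrite sqrrB1; have := W0 w; lra.
rewrite ge0_integralD//.
- by rewrite integral_cst_probability lte_add_pinfty// ltry.
- by move=> w _; rewrite lee_fin sqr_ge0.
- by apply/measurable_EFinP; exact: measurable_funX.
Qed.

Theorem theorem3p5 (R : realType) :
  exists C : R, (0 < C)%R /\
  forall (n : nat) (K : R)
    (mu : 'I_n -> probability (measurableTypeR R) R)
    (P Q : probability (Rn R n) R) (H : R),
    (1 <= n)%N -> (0 < K)%R ->
    (forall i : 'I_n, psi2_norm_le (mu i) K) ->
    is_product_measure mu P ->
    Q `<< P ->
    relative_entropy Q P = H%:E ->
    exists (d : measure_display) (T : measurableType d)
      (Pr : probability T R) (X Y : {RV Pr >-> Rn R n}),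
      has_law X P /\ has_law Y Q /\
      exists U V : 'I_n -> T -> R,
        (forall i : 'I_n,
           is_cond_exp (fun w => `|tnth (X w) i - tnth (Y w) i|)%R X (U i)) /\
        (forall i : 'I_n,
           is_cond_exp (fun w => `|tnth (X w) i - tnth (Y w) i|)%R Y (V i)) /\
        \sum_(i < n) 'E_Pr[fun w => (U i w ^+ 2)%R]
          <= (C * K ^+ 2 * Psi n H)%:E /\
        \sum_(i < n) 'E_Pr[fun w => (V i w ^+ 2)%R]
          <= (C * K ^+ 2 * Psi n H)%:E /\
        'E_Pr[fun w =>
            (eucl_norm (fun i : 'I_n => tnth (X w) i - tnth (Y w) i) ^+ 2)%R]
          <= (C * K ^+ 2 * (Num.sqrt (n%:R * H) + H))%:E.
Proof.
(* [84 = 3 * 28], the constant of [le_Psi] times that of the weak costs. *)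
exists 84%R; split => // n K mu P Q H n0 K0 psi hP QP QH.
have [F [mF F0 QE entF]] := exists_density QP QH.
have F1 : \int[P]_x (F x)%:E = 1.
  rewrite -[RHS](integral_cst_probability Q) QE//.
  by apply: eq_integral => x _; rewrite mule1.
have H0 : (0 <= H)%R.
  by rewrite -lee_fin -entF; apply: integral_ge0 => x _; rewrite lee_fin ent_ge0.
have [d [T [Pr [X0 [Y0 gc]]]]] := exists_transport_coupling K0 psi hP mF F0 F1.
have mX := tc_mX gc; have mY := tc_mY gc.
pose X : {RV Pr >-> Rn R n} := mfun_Sub (mem_set mX).
pose Y : {RV Pr >-> Rn R n} := mfun_Sub (mem_set mY).
pose W i w : R := `|tnth (X0 w) i - tnth (Y0 w) i|%R.
have mW i : measurable_fun setT (W i).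
  apply: (measurableT_comp (@normr_measurable R setT)).
  by apply: measurable_funB; apply: (measurableT_comp (@measurable_tnth _ (measurableTypeR R) n i)).
have W0 i w : (0 <= W i w)%R by exact: normr_ge0.
have mindicE (A : set (Rn R n)) : measurable A ->
    measurable_fun setT (fun x => (\1_A x : R)%:E).
  by move=> mA; apply/measurable_EFinP; exact: measurable_indic.
have lawE (Z : T -> Rn R n) (A : set (Rn R n)) : measurable_fun setT Z -> measurable A ->
    Pr (Z @^-1` A) = \int[Pr]_w (\1_A (Z w))%:E.
  move=> mZ mA; rewrite -[X in Pr X]setIT -integral_indic//.
  by rewrite -[X in measurable X]setTI; exact: (mZ).
have costE r : (0 < r)%R -> \sum_(i < n) \int[Pr]_w (W i w ^+ 2)%:E <=
    (K ^+ 2 * ((20 / r + 18) * H + 8 * r * n%:R))%:E.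
  move=> r0; apply: (le_trans (tc_costE gc r0)).
  by rewrite entF -EFinM -EFinD lee_fin; lra.
have Woo i : \int[Pr]_w (W i w)%:E < +oo.
  apply: integral_lty_of_sqr => //.
  apply: (@le_lt_trans _ _ (\sum_(i < n) \int[Pr]_w (W i w ^+ 2)%:E)).
    rewrite (bigD1 i)//= leeDl// sume_ge0// => j _.
    by apply: integral_ge0 => w _; rewrite lee_fin sqr_ge0.
  by rewrite (le_lt_trans (costE 1%R ltr01))// ltry.
have condX i := exists_cond_exp X (mW i) (W0 i) (Woo i).
have condY i := exists_cond_exp Y (mW i) (W0 i) (Woo i).
have [u hu] := choice condX.
have [v hv] := choice condY.
exists d, T, Pr, X, Y; split.
  move=> A mA; rewrite /distribution /pushforward lawE//.
  rewrite (tc_lawX gc (mindicE _ mA)); last by move=> x; rewrite lee_fin.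
  by rewrite integral_indic// setIT.
split.
  move=> A mA; rewrite /distribution /pushforward lawE//.
  rewrite (tc_lawY gc (mindicE _ mA)); last by move=> x; rewrite lee_fin.
  rewrite -QE; [|exact: mindicE|by move=> x; rewrite lee_fin].
  by rewrite integral_indic// setIT.
exists (fun i => u i \o X), (fun i => v i \o Y).
split; first by move=> i; have [] := hu i.
split; first by move=> i; have [] := hv i.
have K2 : (0 <= K ^+ 2)%R by exact: sqr_ge0.
have k28 : (0 <= 28 * K ^+ 2)%R by rewrite mulr_ge0.
have CE : (84 * K ^+ 2 = 3 * (28 * K ^+ 2))%R by ring.
have EE (Z : T -> R) : 'E_Pr[Z] = \int[Pr]_w (Z w)%:E by rewrite unlock.
split.
  rewrite (eq_bigr _ (fun i _ => EE _)) CE; apply: le_Psi => //.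
    by apply: sume_ge0 => i _; apply: integral_ge0 => w _; rewrite lee_fin sqr_ge0.
  move=> L L0; apply: (@sqr_cond_exp_bound _ _ _ _ _ Pr X n W u) => //.
  - by move=> i; have [] := hu i.
  - by move=> i x; have [] := hu i.
  - by move=> i; have [] := hu i.
  - move=> M phi mphi phiM.
    have phi0 i x : (0 <= phi i x)%R by have /andP[] := phiM i x.
    apply: (le_trans (tc_costX gc L0 mphi phi0)).
    by rewrite entF leeD2r// -EFinM -EFinD lee_fin; lra.
split.
  rewrite (eq_bigr _ (fun i _ => EE _)) CE; apply: le_Psi => //.
    by apply: sume_ge0 => i _; apply: integral_ge0 => w _; rewrite lee_fin sqr_ge0.
  move=> L L0; apply: (@sqr_cond_exp_bound _ _ _ _ _ Pr Y n W v) => //.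
  - by move=> i; have [] := hv i.
  - by move=> i x; have [] := hv i.
  - by move=> i; have [] := hv i.
  - move=> M phi mphi phiM.
    apply: (le_trans (tc_costY gc L0 mphi phiM)).
    by rewrite entF leeD2r// -EFinM -EFinD lee_fin; lra.
rewrite EE.
have -> : \int[Pr]_w (eucl_norm (fun i : 'I_n => tnth (X w) i - tnth (Y w) i) ^+ 2)%:E =
    \sum_(i < n) \int[Pr]_w (W i w ^+ 2)%:E.
  rewrite -ge0_integral_sum//.
  - apply: eq_integral => w _; rewrite sumEFin; congr EFin.
    rewrite /eucl_norm sqr_sqrtr; last by apply: sumr_ge0 => i _; exact: sqr_ge0.
    by apply: eq_bigr => i _; rewrite /W real_normK// num_real.
  - by move=> i; apply/measurable_EFinP; exact: measurable_funX.
  - by move=> i w _; rewrite lee_fin sqr_ge0.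
have SE0 : 0 <= \sum_(i < n) \int[Pr]_w (W i w ^+ 2)%:E.
  by apply: sume_ge0 => i _; apply: integral_ge0 => w _; rewrite lee_fin sqr_ge0.
apply: (le_trans (le_sqrt_entropy K2 H0 n0 SE0 costE)).
rewrite lee_fin; have : (0 <= K ^+ 2 * (Num.sqrt (n%:R * H) + H))%R.
  by rewrite mulr_ge0// addr_ge0// sqrtr_ge0.
lra.
Qed.
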